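(* (i) For every $1<p<\infty$ with $p\neq 2$, there is an $\ell_p$-strictly singular operator $T$ on $L_p$ which is not in the operator-norm closure of the set of operators on $L_p$ that factor through $\ell_2$. (ii) For every $1<p<2$, there is an $\ell_p$-strictly singular operator $T$ on $L_p$ such that for every isometric embedding $J:L_p\to\ell_\infty$, the operator $JT$ is not in the operator-norm closure of the set of operators from $L_p$ into $\ell_\infty$ that factor through $\ell_2$.
   Context: $L_p$ denotes $L_p(0,1)$ (equivalently, $L_p(\mu)$ for any purely non-atomic separable probability measure $\mu$). Operators are bounded and linear. An operator $T:X\to Y$ between Banach spaces is $\ell_p$-strictly singular if there is no closed subspace $Z_0$ of $X$ isomorphic to $\ell_p$ such that the restriction $T_{|Z_0}$ is an isomorphism onto its image. An operator $S:Z\to W$ factors through $\ell_2$ if there are bounded linear operators $A:Z\to \ell_2$ and $B:\ell_2\to W$ with $S=BA$. *)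

(* Defs.v *)
From HB Require Import structures.
From mathcomp Require Import all_boot all_order all_algebra.
From mathcomp Require Import all_classical all_reals all_analysis.
From mathcomp Require Import measurable_realfun ess_sup_inf.

Set Implicit Arguments.
Unset Strict Implicit.
Unset Printing Implicit Defensive.

Import Order.TTheory GRing.Theory Num.Theory.
Import numFieldNormedType.Exports.

Local Open Scope classical_set_scope.
Local Open Scope ring_scope.

(* Scalars are real. L_p(mu) is the library's LspaceType (classes of measurable
   functions with finite L_p norm modulo mu-a.e. equality), which the library
   leaves without any algebraic structure; it is made a normedModType here. *)

Section Lspace_of.
Context d (T : measurableType d) (R : realType).
Variable mu : {measure set T -> \bar R}.
Variables (p : \bar R) (p1 : (1 <= p)%E).

Local Notation Lsp := (LspaceType mu p1).
Local Notation Lfn := (LfunType mu p1).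

Lemma ae_eq_Lnorm (f g : T -> R) :
  measurable_fun setT f -> measurable_fun setT g -> f = g %[ae mu] ->
  'N[mu]_p[EFin \o f]%E = 'N[mu]_p[EFin \o g]%E.
Proof.
move=> mf mg fg; rewrite unlock; case: p p1 => [r r1|_|//].
  congr (_ `^ _)%E; apply: ge0_ae_eq_integral => //.
  - apply/measurable_EFinP; apply: (@measurableT_comp _ _ _ _ _ _ (@powR R ^~ r)) => //.
    exact: measurableT_comp.
  - apply/measurable_EFinP; apply: (@measurableT_comp _ _ _ _ _ _ (@powR R ^~ r)) => //.
    exact: measurableT_comp.
  - by move=> x _; rewrite poweR_ge0.
  - by move=> x _; rewrite poweR_ge0.
  - by apply: filterS fg => x /= /[apply] ->.
case: ifPn => // _; apply: eq_ess_sup.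
by apply: filterS fg => x /= /(_ I) ->.
Qed.

Lemma Lspace_measurable (f : Lsp) : measurable_fun setT (f : T -> R).
Proof. exact: (@measurable_funPT _ _ T (measurableTypeR R) (repr (f : aeEqMfun _ _))). Qed.


Lemma LspaceP (f g : Lsp) : f = g <-> (f : T -> R) = g %[ae mu].
Proof.
split=> [->|fg]; first exact: aeW.
have fgq : (f : {mfun_ mu, T >-> measurableTypeR R}) = g.
  rewrite -[LHS]reprK -[RHS]reprK; apply/eqmodP/asboolP; exact: fg.
case: f g fgq {fg} => [f [[pf]]] [g [[pg]]] /= fgq.
case: _ / fgq pg => pg; by rewrite (bool_irrelevance pf pg).
Qed.

Section of_Lfun.
Variable f : Lfn.

Let f_measurable : measurable_fun setT (f : T -> measurableTypeR R).
Proof. exact: (@measurable_funPT _ _ T R f). Qed.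

Let f_mfun : {mfun T >-> measurableTypeR R} :=
  HB.pack (f : T -> measurableTypeR R)
    (isMeasurableFun.Build _ _ T (measurableTypeR R) f f_measurable).

Let f_class : {mfun_ mu, T >-> measurableTypeR R} :=
  (\pi f_mfun)%qT.

Let f_classE : (f_class : T -> R) = f %[ae mu].
Proof.
have /eqmodP/asboolP := reprK f_class.
by [].
Qed.

Let f_class_measurable : measurable_fun setT (f_class : T -> R).
Proof. exact: (@measurable_funPT _ _ T (measurableTypeR R) (repr f_class)). Qed.

Let f_class_finite : finite_norm mu p (f_class : T -> R).
Proof.
rewrite /finite_norm (ae_eq_Lnorm _ _ f_classE)//.
exact: Lfunction_finite.
Qed.

Definition Lspace_of : Lsp :=
  HB.pack f_class (isFinLebesgue.Build _ T R mu p p1 f_class f_class_finite).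

Lemma Lspace_ofE : (Lspace_of : T -> R) = f %[ae mu].
Proof. exact: f_classE. Qed.

End of_Lfun.

Section to_Lfun.
Variable f : Lsp.

Let f_Lfun : (f : T -> R) \in Lfun mu p.
Proof.
rewrite inE; apply/andP; split; rewrite inE/=; first exact: Lspace_measurable.
exact: Lebesgue_finite.
Qed.

Definition Lfun_of : Lfn := Lfun_Sub p1 f_Lfun.

Lemma Lfun_ofE : (Lfun_of : T -> R) = f.
Proof. by []. Qed.

End to_Lfun.

End Lspace_of.

Local Lemma filterS4 (T : Type) (F : set_system T) : Filter F ->
  forall P Q S U V : set T, (forall x, P x -> Q x -> S x -> U x -> V x) ->
  F P -> F Q -> F S -> F U -> F V.
Proof.
move=> FF P Q S U V h FP FQ FS FU.
by apply: filterS2 (filterI FP FQ) (filterI FS FU) => x [Px Qx] [Sx Ux]; exact: h.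
Qed.

Local Lemma filterS5 (T : Type) (F : set_system T) : Filter F ->
  forall P Q S U V W : set T, (forall x, P x -> Q x -> S x -> U x -> V x -> W x) ->
  F P -> F Q -> F S -> F U -> F V -> F W.
Proof.
move=> FF P Q S U V W h FP FQ FS FU FV.
by apply: filterS3 (filterI FP FQ) (filterI FS FU) FV => x [Px Qx] [Sx Ux]; exact: h.
Qed.

Section Lspace_lmodType.
Context d (T : measurableType d) (R : realType).
Variable mu : {measure set T -> \bar R}.
Variables (p : \bar R) (p1 : (1 <= p)%E).

Local Notation Lsp := (LspaceType mu p1).

HB.instance Definition _ := gen_eqMixin Lsp.
HB.instance Definition _ := gen_choiceMixin Lsp.

Definition Lspace0 : Lsp := Lspace_of 0.
Definition Lspace_add (f g : Lsp) : Lsp := Lspace_of (Lfun_of f + Lfun_of g).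
Definition Lspace_opp (f : Lsp) : Lsp := Lspace_of (- Lfun_of f).
Definition Lspace_scale (a : R) (f : Lsp) : Lsp := Lspace_of (a *: Lfun_of f).

Lemma Lspace0E : (Lspace0 : T -> R) = cst 0 %[ae mu].
Proof. exact: Lspace_ofE. Qed.

Lemma Lspace_addE (f g : Lsp) :
  (Lspace_add f g : T -> R) = (f : T -> R) \+ g %[ae mu].
Proof. exact: Lspace_ofE. Qed.

Lemma Lspace_oppE (f : Lsp) : (Lspace_opp f : T -> R) = \- (f : T -> R) %[ae mu].
Proof. exact: Lspace_ofE. Qed.

Lemma Lspace_scaleE a (f : Lsp) :
  (Lspace_scale a f : T -> R) = a \*: (f : T -> R) %[ae mu].
Proof. exact: Lspace_ofE. Qed.

Let addA : associative Lspace_add.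
Proof.
move=> f g h; apply/LspaceP.
have := Lspace_addE f (Lspace_add g h); have := Lspace_addE g h.
have := Lspace_addE (Lspace_add f g) h; have := Lspace_addE f g.
by apply: filterS4 => x /(_ I)/= E1 /(_ I)/= E2 /(_ I)/= E3 /(_ I)/= E4 _;
  rewrite E4 E3 E2 E1 addrA.
Qed.

Let addC : commutative Lspace_add.
Proof.
move=> f g; apply/LspaceP.
have := Lspace_addE f g; have := Lspace_addE g f.
by apply: filterS2 => x /(_ I)/= E1 /(_ I)/= E2 _; rewrite E1 E2 addrC.
Qed.

Let add0 : left_id Lspace0 Lspace_add.
Proof.
move=> f; apply/LspaceP.
have := Lspace_addE Lspace0 f; have := Lspace0E.
by apply: filterS2 => x /(_ I)/= E1 /(_ I)/= E2 _; rewrite E2 E1 add0r.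
Qed.

Let addN : left_inverse Lspace0 Lspace_opp Lspace_add.
Proof.
move=> f; apply/LspaceP.
have := Lspace_addE (Lspace_opp f) f; have := Lspace_oppE f; have := Lspace0E.
by apply: filterS3 => x /(_ I)/= E1 /(_ I)/= E2 /(_ I)/= E3 _;
  rewrite E3 E2 E1 addNr.
Qed.

HB.instance Definition _ := GRing.isZmodule.Build Lsp addA addC add0 addN.

Let scaleA a b (f : Lsp) :
  Lspace_scale a (Lspace_scale b f) = Lspace_scale (a * b) f.
Proof.
apply/LspaceP.
have := Lspace_scaleE a (Lspace_scale b f); have := Lspace_scaleE b f.
have := Lspace_scaleE (a * b) f.
by apply: filterS3 => x /(_ I)/= E1 /(_ I)/= E2 /(_ I)/= E3 _;
  rewrite E3 E2 E1 /= scalerA.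
Qed.

Let scale1 : left_id 1 Lspace_scale.
Proof.
move=> f; apply/LspaceP; have := Lspace_scaleE 1 f.
by apply: filterS => x /(_ I)/= E1 _; rewrite E1 scale1r.
Qed.

Let scaleDr : right_distributive Lspace_scale +%R.
Proof.
move=> a f g; apply/LspaceP.
have := Lspace_scaleE a (f + g); have := Lspace_addE f g.
have := Lspace_addE (Lspace_scale a f) (Lspace_scale a g).
have := Lspace_scaleE a f; have := Lspace_scaleE a g.
by apply: filterS5 => x /(_ I)/= E1 /(_ I)/= E2 /(_ I)/= E3 /(_ I)/= E4 /(_ I)/= E5 _;
  rewrite E5 E4 E3 E2 E1 scalerDr.
Qed.

Let scaleDl (f : Lsp) : {morph Lspace_scale^~ f : a b / a + b}.
Proof.
move=> a b; apply/LspaceP.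
have := Lspace_scaleE (a + b) f.
have := Lspace_addE (Lspace_scale a f) (Lspace_scale b f).
have := Lspace_scaleE a f; have := Lspace_scaleE b f.
by apply: filterS4 => x /(_ I)/= E1 /(_ I)/= E2 /(_ I)/= E3 /(_ I)/= E4 _;
  rewrite E4 E3 E2 E1 scalerDl.
Qed.

HB.instance Definition _ :=
  GRing.Zmodule_isLmodule.Build R Lsp scaleA scale1 scaleDr scaleDl.

Definition Lspace_norm (f : Lsp) : R := fine 'N[mu]_p[EFin \o f]%E.

Lemma Lspace_normE (f : Lsp) : (Lspace_norm f)%:E = 'N[mu]_p[EFin \o f]%E.
Proof. exact: (finite_norm_fine (Lfun_of f)). Qed.

Let norm_of (f : LfunType mu p1) :
  Lspace_norm (Lspace_of f) = fine 'N[mu]_p[EFin \o f]%E.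
Proof.
rewrite /Lspace_norm (ae_eq_Lnorm p1 _ _ (Lspace_ofE f))//.
exact: Lspace_measurable.
Qed.

Let ler_normD (f g : Lsp) :
  Lspace_norm (f + g) <= Lspace_norm f + Lspace_norm g.
Proof. by rewrite norm_of; exact: ler_LnormD. Qed.

Let normrZ (a : R) (f : Lsp) : Lspace_norm (a *: f) = `|a| * Lspace_norm f.
Proof.
rewrite norm_of; have := congr1 fine (LnormZ (Lfun_of f) a).
by rewrite -(Lspace_normE f) -EFinM.
Qed.

Let normr0_eq0 (f : Lsp) : Lspace_norm f = 0 -> f = 0.
Proof.
move=> /(fine_Lnormr_eq0 (f := Lfun_of f)) f0; apply/LspaceP.
have := Lspace0E; move: f0.
by apply: filterS2 => x /(_ I)/= E1 /(_ I)/= E2 _; rewrite E1 E2.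
Qed.

HB.instance Definition _ :=
  Lmodule_isNormed.Build R Lsp ler_normD normrZ normr0_eq0.

Lemma normr_LspaceE (f : Lsp) : (`|f|%:E = 'N[mu]_p[EFin \o f])%E.
Proof. exact: Lspace_normE. Qed.

End Lspace_lmodType.

Section function_spaces.
Variable R : realType.

Definition lebesgue01 : {measure set (measurableTypeR R) -> \bar R} :=
  mrestr lebesgue_measure (measurable_itv `]0, 1[%R).

Definition Lp01 (p : \bar R) (p1 : (1 <= p)%E) : normedModType R :=
  LspaceType lebesgue01 p1.

(* nat carries the discrete sigma-algebra and the only null set of the counting
   measure is empty, so that elements of ellp are sequences, with norm
   (\sum_n |x_n|^p)^(1/p) for finite p and \sup_n |x_n| for p = +oo *)
Definition ellp (p : \bar R) (p1 : (1 <= p)%E) : normedModType R :=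
  LspaceType (counting : {measure set nat -> \bar R}) p1.

Definition ell2 : normedModType R := @ellp 2%:E (lee1n 2).

Definition ellinfty : normedModType R := ellp (leey 1).

Lemma exponent_ge1 (p : R) : 1 < p -> (1 <= p%:E)%E.
Proof. by rewrite lee_fin; exact: ltW. Qed.

End function_spaces.
Arguments ell2 R : clear implicits.
Arguments ellinfty R : clear implicits.

Section operators.
Context {R : realType}.
Implicit Types X Y : normedModType R.

Definition bounded_linear X Y (T : {linear X -> Y}) : Prop :=
  exists C : R, forall x, `|T x| <= C * `|x|.

(* relevant for bounded T only: sup is 0 on unbounded sets *)
Definition opnorm X Y (T : X -> Y) : R :=
  sup [set `|T x| | x in [set x : X | `|x| <= 1]].

(* used for A a set of bounded linear operators and T a bounded linear operator,
   so that opnorm is only applied to such operators *)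
Definition opnorm_closure X Y (A : set (X -> Y)) : set (X -> Y) :=
  [set T | forall e : R, 0 < e -> exists2 S, A S & opnorm (T \- S) < e].

Definition factors_through_ell2 X Y : set (X -> Y) :=
  [set S | exists (A : {linear X -> ell2 R}) (B : {linear ell2 R -> Y}),
    [/\ bounded_linear A, bounded_linear B & S = B \o A]].

Definition linear_subspace X (Z : set X) : Prop :=
  Z 0 /\ forall (a : R) x y, Z x -> Z y -> Z (a *: x + y).

(* U restricts to an isomorphism of the subspace A onto the subspace B: a linear
   bijection that is bounded, with bounded inverse *)
Definition isomorphism_on X Y (A : set X) (B : set Y) (U : {linear X -> Y}) :
    Prop :=
  [/\ set_bij A B U,
      exists C : R, forall x, A x -> `|U x| <= C * `|x|
    & exists C : R, forall x, A x -> `|x| <= C * `|U x|].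

Definition ellp_strictly_singular (p : \bar R) (p1 : (1 <= p)%E) X Y
    (T : {linear X -> Y}) : Prop :=
  ~ exists Z0 : set X,
      [/\ linear_subspace Z0, closed Z0,
          exists U : {linear ellp p1 -> X}, isomorphism_on setT Z0 U
        & isomorphism_on Z0 (T @` Z0) T].

Definition isometric_embedding X Y (J : {linear X -> Y}) : Prop :=
  forall x, `|J x| = `|x|.

End operators.

(* Main.v *)
Require Import Defs.
From HB Require Import structures.
From mathcomp Require Import all_boot all_order all_algebra.
From mathcomp Require Import all_classical all_reals all_analysis.
From mathcomp Require Import measurable_realfun.
From mathcomp Require Import ring lra.

(* Let [1/p + 1/P = 1] with [p < 2 < P], and let [1/Q] be the mean of [1/2] and
   [1/P], [1/q + 1/Q = 1].  In [L_P] take, for each level [n], [D^2] independent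
   symmetric functions [h] with values in [{0, H, -H}] and support of relative
   measure [1/D], [D = 2^n], the levels being disjoint.  By Rosenthal's inequality
   they satisfy an upper [Q]-estimate in [L_P].  In [L_q] take the indicators [f] of
   the dyadic intervals of length [1/D^2], normalized and multiplied by a
   Rademacher function of the level; these satisfy an upper [q]-estimate since the
   levels form a martingale.  By duality [x |-> sum <x, h> f] is bounded on [L_p]
   and [y |-> sum <y, f> h] on [L_P], and since both factor through coefficient
   spaces of exponent [q], [Q], comparing averages over signs shows that they fix no
   copy of [ell_p], [ell_P].  For a level sum [x] of the [h] with random signs
   [|T x|_p >= |x|_p], whereas a bounded [A : L_p -> ell_2] has
   [E |A x|^2 = sum |A h|^2 <= |A|^2 D^2 max |h|_p^2], which is of smaller order
   than [|x|_p^2]; so [|T x| <= b |A x| + |x| / 2] fails for large [n], in [L_p] as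
   well as after an isometric embedding into [ell_infty].  Above [2] one bounds
   instead the trace of [<S f, h>] for [S] factoring through [ell_2].  All averages
   over signs are replaced by greedy choices of signs. *)

Set Implicit Arguments.
Unset Strict Implicit.
Unset Printing Implicit Defensive.

Import Order.TTheory GRing.Theory Num.Theory.
Import numFieldNormedType.Exports.

Local Open Scope classical_set_scope.
Local Open Scope ring_scope.

(** * Power inequalities *)

Section power_inequalities.
Variable R : realType.
Implicit Types (a b x y u v k r : R).

(** The exponent [Q] is forced by flat level sums. With [|h|_P = 1], the sum of all [D^2] functions
    of a level has norm of order [D^(1/2 + 1/P)] in [L_P], while its coefficients have [ell_Q] norm
    [D^(2/Q)]; so [2/Q = 1/2 + 1/P] is the best upper estimate available. The same identity, read as
    [2/q = 1/2 + 1/p], is what keeps [T] from contracting flat level sums. In the chain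
    [p < q < 2 < Q < P] the outer gaps forbid fixed copies, since [m^(1/p)] and [m^(1/q)] grow at
    different rates, and [q < 2] makes the Hilbertian estimates fall short by the factor
    [D^(2/q - 1)]. The coefficient spaces are never built: each operator comes with a functional
    [G], the limit of the sums of [|phi n s x|^r], which inherits Clarkson's inequality from the
    scalars. This inequality is all the type or cotype that a greedy choice of signs requires.
    Likewise there is no probability space: independence is carried by the base-[b] digits of a cell
    index, and expectations are the finite averages [avg]. *)

Lemma ler_powR2r r x y : 0 <= r -> 0 <= x -> x <= y -> x `^ r <= y `^ r.
Proof.
by move=> r0 x0 xy; apply: ge0_ler_powR => //; rewrite nnegrE// (le_trans x0).
Qed.

Lemma powRVK r x : 0 < r -> 0 <= x -> (x `^ r^-1) `^ r = x.
Proof. by move=> r0 x0; rewrite -powRrM mulVf ?gt_eqF// powRr1. Qed.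

Lemma powRKV r x : 0 < r -> 0 <= x -> (x `^ r) `^ r^-1 = x.
Proof. by move=> r0 x0; rewrite -powRrM mulfV ?gt_eqF// powRr1. Qed.

Lemma ler_powR_inv r x y : 0 < r -> 0 <= x -> 0 <= y ->
  x `^ r <= y `^ r -> x <= y.
Proof.
move=> r0 x0 y0 xy; rewrite -(powRKV r0 x0) -(powRKV r0 y0).
by rewrite ler_powR2r ?powR_ge0// invr_ge0 ltW.
Qed.

(** Write each power as [z * z ^ (k - 1)] and use that the second factor is monotone. *)
Lemma powR_superadd k x y : 1 <= k -> 0 <= x -> 0 <= y ->
  x `^ k + y `^ k <= (x + y) `^ k.
Proof.
move=> k1 x0 y0; have k0 : 0 < k by rewrite (lt_le_trans ltr01).
rewrite -[leRHS]mulr_powRB1 ?addr_ge0// mulrDl.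
rewrite -(mulr_powRB1 x0 k0) -(mulr_powRB1 y0 k0).
by rewrite lerD// ler_wpM2l// ler_powR2r ?subr_ge0// ?lerDl ?lerDr.
Qed.

Lemma powR_subadd k x y : 0 < k -> k <= 1 -> 0 <= x -> 0 <= y ->
  (x + y) `^ k <= x `^ k + y `^ k.
Proof.
move=> k0 k1 x0 y0.
rewrite -[leRHS](@powRVK k)// ?addr_ge0 ?powR_ge0//.
rewrite ler_powR2r ?addr_ge0 ?(ltW k0)//.
rewrite -{1}(powRKV k0 x0) -{1}(powRKV k0 y0).
by rewrite powR_superadd ?powR_ge0// invf_ge1.
Qed.

Lemma powR_mid k x y : 1 <= k -> 0 <= x -> 0 <= y ->
  ((x + y) / 2) `^ k <= (x `^ k + y `^ k) / 2.
Proof.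
move=> k1 x0 y0.
have h0 : 0 <= 2^-1 :> R by lra.
have h1 : 2^-1 <= 1 :> R by lra.
have := convex_powR k1 (Itv01 h0 h1) (x := x) (y := y).
rewrite !inE/= !in_itv/= !andbT => /(_ x0 y0).
rewrite !convRE/= => H.
have {H} : (2^-1 * x + (1 - 2^-1) * y) `^ k <=
  2^-1 * x `^ k + (1 - 2^-1) * y `^ k := H.
rewrite (_ : 1 - 2^-1 = 2^-1); last by lra.
by rewrite -!mulrDr mulrC [in leRHS]mulrC.
Qed.

Lemma normr_powR_sqr r x : `|x| `^ r = (x ^+ 2) `^ (r / 2).
Proof.
rewrite -(real_normK (num_real x)) -(powR_mulrn _ (normr_ge0 x)) -powRrM.
by congr (_ `^ _); lra.
Qed.

(** In squares, with [k = r / 2 >= 1]: superadditivity bounds the left side by [(x^2 + y^2) ^ k],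
    and [x^2 + y^2] is the midpoint of [(x + y)^2] and [(x - y)^2]. *)
Lemma clarkson_ge r x y : 2 <= r ->
  2 * (`|x| `^ r + `|y| `^ r) <= `|x + y| `^ r + `|x - y| `^ r.
Proof.
move=> r2; rewrite !normr_powR_sqr; set k := r / 2.
have k1 : 1 <= k by rewrite /k; lra.
have := powR_superadd k1 (sqr_ge0 x) (sqr_ge0 y).
have := powR_mid k1 (sqr_ge0 (x + y)) (sqr_ge0 (x - y)).
rewrite (_ : ((x + y) ^+ 2 + (x - y) ^+ 2) / 2 = x ^+ 2 + y ^+ 2); last by field.
lra.
Qed.

(** Now [k = r / 2 <= 1], so midpoint convexity is used for the exponent [1 / k], at the numbers
    [((x + y)^2) ^ k] and [((x - y)^2) ^ k], and subadditivity finishes. *)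
Lemma clarkson_le r x y : 0 < r -> r <= 2 ->
  `|x + y| `^ r + `|x - y| `^ r <= 2 * (`|x| `^ r + `|y| `^ r).
Proof.
move=> r0 r2; rewrite !normr_powR_sqr; set k := r / 2.
have k0 : 0 < k by rewrite /k; lra.
have k1 : k <= 1 by rewrite /k; lra.
have := powR_subadd k0 k1 (sqr_ge0 x) (sqr_ge0 y).
have k'1 : 1 <= k^-1 by rewrite invf_ge1.
have := powR_mid k'1 (powR_ge0 ((x + y) ^+ 2) k) (powR_ge0 ((x - y) ^+ 2) k).
rewrite !powRKV ?sqr_ge0//.
rewrite (_ : ((x + y) ^+ 2 + (x - y) ^+ 2) / 2 = x ^+ 2 + y ^+ 2); last by field.
move=> /(ler_powR2r (ltW k0) (powR_ge0 _ _)); rewrite powRVK//.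
  lra.
by rewrite divr_ge0// addr_ge0 ?powR_ge0.
Qed.

(** The excess over 1 is [(e - f)^2 / 2] for [e = exp(u/2)], [f = exp(-u/2)], and
    [e - f = e (1 - exp(-u)) <= u e]. *)
Lemma cosh_bound u : 0 <= u ->
  (expR u + expR (- u)) / 2 <= 1 + u ^+ 2 * expR u / 2.
Proof.
move=> u0.
set e := expR (u / 2); set f := expR (- (u / 2)).
have ue : expR u = e ^+ 2 by rewrite /e expr2 -expRD -splitr.
have uf : expR (- u) = f ^+ 2 by rewrite /f expr2 -expRD -opprD -splitr.
have ef : e * f = 1 by rewrite /e /f -expRD subrr expR0.
have e0 : 0 < e by exact: expR_gt0.
have f1 : 1 - u <= f ^+ 2 by rewrite -uf; have := expR_ge1Dx (- u); lra.
have fe : 0 <= e - f by rewrite subr_ge0 ler_expR; lra.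
have h : e - f <= u * e.
  have -> : e - f = e * (1 - f ^+ 2) by rewrite mulrBr mulr1 expr2 mulrA ef mul1r.
  by rewrite mulrC ler_pM2r//; lra.
have : (e - f) ^+ 2 <= (u * e) ^+ 2 by rewrite lerXn2r// nnegrE// mulr_ge0// ltW.
rewrite ue uf; nra.
Qed.

(** The first summand comes from [cosh_bound] at [u = r t] with [t <= 1]; the second covers
    [|x| <= |y|], where both [|x + y|] and [|x - y|] are at most [2 |y|]. *)
Definition rosenthal_const r := r ^+ 2 * expR r / 2 + 2 `^ r.

Lemma rosenthal_const_ge1 r : 0 <= r -> 1 <= rosenthal_const r.
Proof.
move=> r0; rewrite /rosenthal_const -[leLHS]add0r lerD//.
  by rewrite divr_ge0// mulr_ge0 ?expR_ge0// sqr_ge0.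
by rewrite -[leLHS](powRr0 2) ler_powR// ler1n.
Qed.

Lemma powR_expR r t : 0 <= r -> 0 <= 1 + t -> (1 + t) `^ r <= expR (r * t).
Proof.
by move=> r0 t0; rewrite mulrC expRM ler_powR2r// expR_ge1Dx.
Qed.

Lemma powR_symm_small r t : 1 <= r -> 0 <= t -> t <= 1 ->
  ((1 + t) `^ r + (1 - t) `^ r) / 2 <= 1 + rosenthal_const r * t ^+ 2.
Proof.
move=> r1 t0 t1; have r0 : 0 <= r by lra.
have h1 : (1 + t) `^ r <= expR (r * t) by apply: powR_expR => //; lra.
have h2 : (1 - t) `^ r <= expR (- (r * t)).
  by rewrite -mulrN; apply: powR_expR => //; lra.
have h3 := cosh_bound (mulr_ge0 r0 t0).
have h4 : expR (r * t) <= expR r by rewrite ler_expR; nra.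
have h5 : (r * t) ^+ 2 * expR (r * t) <= (r * t) ^+ 2 * expR r.
  by rewrite ler_wpM2l ?sqr_ge0.
have h6 : 0 <= 2 `^ r * t ^+ 2 by rewrite mulr_ge0 ?powR_ge0 ?sqr_ge0.
rewrite /rosenthal_const mulrDl; rewrite exprMn in h3 h5; lra.
Qed.

(** Averaging over the sign of [y] cancels the first-order term. For [|y| < |x|], homogeneity
    reduces the claim to [t = |y| / |x|] and [powR_symm_small]; otherwise the term [|y| ^ r] alone
    suffices. *)
Lemma rosenthal_step r x y : 2 <= r ->
  (`|x + y| `^ r + `|x - y| `^ r) / 2 <=
  `|x| `^ r + rosenthal_const r * (y ^+ 2 * `|x| `^ (r - 2) + `|y| `^ r).
Proof.
move=> r2; have r0 : 0 <= r by lra.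
have c1 := rosenthal_const_ge1 r0.
have c2 : 2 `^ r <= rosenthal_const r.
  by rewrite /rosenthal_const lerDr divr_ge0// mulr_ge0 ?expR_ge0 ?sqr_ge0.
have [xy|yx] := leP `|x| `|y|.
  have h z : `|z| <= 2 * `|y| -> `|z| `^ r <= 2 `^ r * `|y| `^ r.
    by move=> zy; rewrite -powRM// ler_powR2r.
  have h1 : `|x + y| `^ r <= 2 `^ r * `|y| `^ r.
    by apply: h; rewrite (le_trans (ler_normD _ _))//; lra.
  have h2 : `|x - y| `^ r <= 2 `^ r * `|y| `^ r.
    by apply: h; rewrite (le_trans (ler_normB _ _))//; lra.
  have h3 : 2 `^ r * `|y| `^ r <= rosenthal_const r * `|y| `^ r.
    by rewrite ler_wpM2r ?powR_ge0.
  have h4 : 0 <= rosenthal_const r * (y ^+ 2 * `|x| `^ (r - 2)).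
    by apply: mulr_ge0; [lra|rewrite mulr_ge0 ?powR_ge0 ?sqr_ge0].
  by have := powR_ge0 `|x| r; rewrite mulrDr; lra.
have x0 : 0 < `|x| by rewrite (le_lt_trans _ yx).
set t := `|y| / `|x|.
have t0 : 0 <= t by rewrite divr_ge0.
have t1 : t <= 1 by rewrite ler_pdivrMr// mul1r ltW.
have yE : `|y| = t * `|x| by rewrite /t divfK// gt_eqF.
(* Up to order, the pair [|x + y|], [|x - y|] is the pair [|x| + |y|], [| |x| - |y| |]. *)
have hs : `|x + y| `^ r + `|x - y| `^ r <=
    (`|x| + `|y|) `^ r + (`|x| - `|y|) `^ r.
  have P u v : (`|u + v| = `|u| + `|v| /\ `|u - v| = `| `|u| - `|v| |) \/
      (`|u + v| = `| `|u| - `|v| | /\ `|u - v| = `|u| + `|v|).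
    by case: (ger0P u) => u0; case: (ger0P v) => v0;
      [left|right|right|left]; split;
      first [by rewrite ger0_norm; lra|by rewrite ler0_norm; lra
            |by congr `| _ |; lra|by rewrite -normrN; congr `| _ |; lra].
  have := P x y; rewrite (@ger0_norm _ (`|x| - `|y|)); last first.
    by rewrite subr_ge0 ltW.
  by move=> [[-> ->]|[-> ->]]; rewrite // addrC.
have h := powR_symm_small (_ : 1 <= r) t0 t1.
have {}h := h ltac:(lra).
have e1 : (`|x| + `|y|) `^ r = (1 + t) `^ r * `|x| `^ r.
  by rewrite -powRM//; [congr (_ `^ _); rewrite yE; ring|lra].
have e2 : (`|x| - `|y|) `^ r = (1 - t) `^ r * `|x| `^ r.
  by rewrite -powRM//; [congr (_ `^ _); rewrite yE; ring|lra].
have e3 : y ^+ 2 * `|x| `^ (r - 2) = t ^+ 2 * `|x| `^ r.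
  rewrite -(real_normK (num_real y)) yE exprMn -mulrA; congr (_ * _).
  rewrite -powR_mulrn// -powRD; last by rewrite (gt_eqF x0) implybT.
  by congr (_ `^ _); lra.
have X0 := powR_ge0 `|x| r.
have := ler_wpM2r X0 h.
rewrite e1 e2 in hs; rewrite e3.
have : 0 <= rosenthal_const r * `|y| `^ r by rewrite mulr_ge0 ?powR_ge0//; lra.
rewrite mulrDr; lra.
Qed.

(** If [Y < X], then [Y] is itself at most the mixed term, so [X <= 2 K Y^(2/P) X^(1 - 2/P)]; cancel
    the power of [X] and raise to the power [P / 2]. *)
Lemma power_absorb (K P X Y : R) : 2 < P -> 1 <= K -> 0 <= X -> 0 <= Y ->
  X <= K * (Y + Y `^ (2 / P) * X `^ (1 - 2 / P)) -> X <= (2 * K) `^ (P / 2) * Y.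
Proof.
move=> P2 K1 X0 Y0 h.
have P0 : 0 < P by lra.
have iP : 0 < 2 / P by rewrite divr_gt0.
have iP1 : 2 / P < 1 by rewrite ltr_pdivrMr// mul1r.
have [XY|YX] := leP X Y.
  rewrite (le_trans XY)// -[leLHS]mul1r ler_wpM2r//.
  by rewrite -[leLHS](powRr0 (2 * K)) ler_powR; lra.
have X0' : 0 < X by lra.
have h1 : Y <= Y `^ (2 / P) * X `^ (1 - 2 / P).
  have YE : Y = Y `^ (2 / P) * Y `^ (1 - 2 / P).
    rewrite -powRD; last by apply/implyP; lra.
    by rewrite subrKC powRr1.
  by rewrite {1}YE ler_wpM2l ?powR_ge0// ler_powR2r; lra.
have h2 : X <= 2 * K * Y `^ (2 / P) * X `^ (1 - 2 / P).
  have := ler_wpM2l (_ : 0 <= K) h1 => /(_ ltac:(lra)); lra.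
have h3 : X `^ (2 / P) <= 2 * K * Y `^ (2 / P).
  have Xp : 0 < X `^ (1 - 2 / P) by exact: powR_gt0.
  rewrite -(ler_pM2r Xp) -powRD; last by rewrite (gt_eqF X0') implybT.
  by rewrite subrKC powRr1// ltW.
have := ler_powR2r (_ : 0 <= P / 2) (powR_ge0 _ _) h3.
move=> /(_ ltac:(lra)).
rewrite powRM ?powR_ge0//; last lra.
have E : 2 / P * (P / 2) = 1 by field; rewrite gt_eqF.
by rewrite -!powRrM E !powRr1.
Qed.

End power_inequalities.

(** * Averages over finite intervals of indices *)

Section averages.
Variable R : realType.
Implicit Types (u v : nat -> R) (n m : nat) (c k r s : R).

Definition avg n u : R := (\sum_(i < n) u i) / n%:R.

Lemma eq_avg n u v : (forall i, (i < n)%N -> u i = v i) -> avg n u = avg n v.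
Proof. by move=> uv; congr (_ / _); apply: eq_bigr => i _; exact: uv. Qed.

Lemma ler_avg n u v : (forall i, (i < n)%N -> u i <= v i) -> avg n u <= avg n v.
Proof. by move=> uv; rewrite ler_wpM2r// ler_sum// => i _; exact: uv. Qed.

Lemma avg_ge0 n u : (forall i, (i < n)%N -> 0 <= u i) -> 0 <= avg n u.
Proof. by move=> u0; rewrite divr_ge0// sumr_ge0// => i _; exact: u0. Qed.

Lemma avgD n u v : avg n (fun i => u i + v i) = avg n u + avg n v.
Proof. by rewrite /avg big_split/= mulrDl. Qed.

Lemma avgZ n c u : avg n (fun i => c * u i) = c * avg n u.
Proof. by rewrite /avg -mulr_sumr mulrA. Qed.

Lemma avg_cst n c : (0 < n)%N -> avg n (fun=> c) = c.
Proof.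
move=> n0; rewrite /avg sumr_const card_ord -[c *+ n]mulr_natr mulfK//.
by rewrite pnatr_eq0 -lt0n.
Qed.

Lemma avg_jensen n k u : 1 <= k -> (forall i, (i < n)%N -> 0 <= u i) ->
  (avg n u) `^ k <= avg n (fun i => u i `^ k).
Proof.
move=> k1 u0; have [->|n0] := posnP n.
  by rewrite /avg !invr0 !mulr0 powR0// gt_eqF//; lra.
have [<-|kn1] := eqVneq 1 k.
  rewrite powRr1 ?avg_ge0//; apply: ler_avg => i ni.
  by rewrite powRr1// u0.
have {kn1} k1' : 1 < k by rewrite lt_neqAle kn1.
have k0 : 0 < k by lra.
have m0 := avg_ge0 u0; set m := avg n u in m0 *.
pose k' := k / (k - 1).
have k'0 : 0 < k' by rewrite divr_gt0//; lra.
have kk : k^-1 + k'^-1 = 1 by rewrite /k' invf_div; field; rewrite gt_eqF.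
have mk : (m `^ (k - 1)) `^ k' = m `^ k.
  by rewrite -powRrM; congr (_ `^ _); rewrite /k'; field; rewrite gt_eqF//; lra.
(* Young's inequality at the mean [m], which is the tangent line of the [k]-th power there;
   averaging it gives Jensen. *)
have h i : (i < n)%N -> m `^ (k - 1) * u i <= k^-1 * u i `^ k + k'^-1 * m `^ k.
  move=> ni; have := conjugate_powR (u0 i ni) (powR_ge0 m (k - 1)) k0 k'0 kk.
  by rewrite mk; lra.
have := ler_avg h; rewrite avgD !avgZ avg_cst// -/m.
rewrite [m `^ _ * m]mulrC mulr_powRB1//.
rewrite (_ : k'^-1 = 1 - k^-1); last by lra.
move=> {}h; have : k^-1 * m `^ k <= k^-1 * avg n (fun i => u i `^ k) by lra.
by rewrite ler_pM2l ?invr_gt0.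
Qed.

Lemma avg_powR_le n r s u : 0 < s -> s <= r ->
  avg n (fun i => `|u i| `^ s) <= (avg n (fun i => `|u i| `^ r)) `^ (s / r).
Proof.
move=> s0 sr; have r0 : 0 < r by lra.
have h : 1 <= r / s by rewrite ler_pdivlMr// mul1r.
have a0 : 0 <= avg n (fun i => `|u i| `^ s) by apply: avg_ge0.
have := @avg_jensen n _ (fun i => `|u i| `^ s) h (fun i _ => powR_ge0 _ _).
rewrite (@eq_avg _ (fun i => (`|u i| `^ s) `^ (r / s)) (fun i => `|u i| `^ r)).
  2: by move=> i _; rewrite -powRrM [s * _]mulrC divfK ?gt_eqF.
have sr0 : 0 <= s / r by rewrite divr_ge0// ltW.
move=> /(ler_powR2r sr0 (powR_ge0 _ _)).
have E : r / s * (s / r) = 1 by field; rewrite !gt_eqF.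
by rewrite -powRrM E powRr1.
Qed.

Lemma sum_mul_ord (V : nmodType) m n (F : nat -> V) :
  \sum_(j < m * n) F j = \sum_(i < m) \sum_(j < n) F (i * n + j)%N.
Proof.
elim: m => [|m IH]; first by rewrite mul0n !big_ord0.
by rewrite big_ord_recr/= -IH mulSnr big_split_ord.
Qed.

Lemma avg_mul m n u :
  avg (m * n) u = avg m (fun i => avg n (fun j => u (i * n + j)%N)).
Proof.
rewrite /avg sum_mul_ord natrM invfM -mulr_suml [_^-1 * _]mulrC !mulrA.
by [].
Qed.

Lemma avg_divn m n u : (0 < n)%N -> avg (m * n) (fun j => u (j %/ n)%N) = avg m u.
Proof.
move=> n0; rewrite avg_mul; apply: eq_avg => i _.
rewrite -[RHS](avg_cst _ n0); apply: eq_avg => j jn.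
by rewrite divnMDl// divn_small// addn0.
Qed.

Lemma sum_powR_sqr_le n r u : 2 <= r ->
  \sum_(i < n) u i ^+ 2 <=
  n%:R `^ (1 - 2 / r) * (\sum_(i < n) `|u i| `^ r) `^ (2 / r).
Proof.
move=> r2; have [->|n0] := posnP n.
  by rewrite !big_ord0 mulr_ge0// powR_ge0.
have nn : 0 < n%:R :> R by rewrite ltr0n.
have := @avg_powR_le n r 2 u (ltr0n _ 2) r2.
rewrite (@eq_avg _ (fun i => `|u i| `^ 2) (fun i => u i ^+ 2)); last first.
  by move=> i _; rewrite powR_mulrn// real_normK ?num_real.
rewrite /avg ler_pdivrMr// => /le_trans; apply.
have E : n%:R^-1 `^ (2 / r) = n%:R `^ (- (2 / r)) :> R.
  by rewrite -powR_inv1 ?(ltW nn)// -powRrM mulN1r.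
rewrite powRM ?invr_ge0 ?(ltW nn)//; last first.
  by apply: sumr_ge0 => *; exact: powR_ge0.
rewrite E -mulrA [leRHS]mulrC ler_wpM2l ?powR_ge0//.
rewrite -{2}(powRr1 (ltW nn)) -powRD; last by rewrite (gt_eqF nn) implybT.
by rewrite ler_powR// ?ler1n//; lra.
Qed.

Lemma sum_powR_le n r s u : 0 < r -> r <= s ->
  \sum_(i < n) `|u i| `^ s <= (\sum_(i < n) `|u i| `^ r) `^ (s / r).
Proof.
move=> r0 rs; have sr : 1 <= s / r by rewrite ler_pdivlMr// mul1r.
elim: n => [|n IH]; first by rewrite !big_ord0 powR_ge0.
rewrite !big_ord_recr/=.
apply: le_trans (powR_superadd sr _ _); rewrite ?sumr_ge0 ?powR_ge0//.
by rewrite lerD// -powRrM mulrCA divff ?mulr1 ?gt_eqF.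
Qed.

End averages.

(** * Greedy choice of signs *)

Section signs.
Variables (R : realType) (V : lmodType R).

(** The two candidates for the next sign have mean at most [Psi x + Psi (v m)], so one of them stays
    below it. [Psi] need not be positive: it is later an energy or its negative, a squared [ell_2]
    seminorm or its negative, and an indefinite quadratic form. *)
Lemma exists_signs (Psi : V -> R) (v : nat -> V) (m : nat) : Psi 0 <= 0 ->
  (forall x y, Psi (x + y) + Psi (x - y) <= 2 * (Psi x + Psi y)) ->
  exists eps : nat -> bool,
    Psi (\sum_(i < m) (-1) ^+ eps i *: v i) <= \sum_(i < m) Psi (v i).
Proof.
move=> Psi0 H; elim: m => [|m [eps IH]].
  by exists (fun=> false); rewrite !big_ord0.
set x := \sum_(i < m) _ in IH.
have key : exists b : bool, Psi (x + (-1) ^+ b *: v m) <= Psi x + Psi (v m).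
  have := H x (v m).
  have [h _|h1 h2] := leP (Psi (x + v m)) (Psi x + Psi (v m)).
    by exists false; rewrite scale1r.
  by exists true; rewrite expr1 scaleN1r; lra.
have [b hb] := key.
exists (fun i => if i == m then b else eps i).
rewrite !big_ord_recr/= eqxx.
rewrite (eq_bigr (fun i : 'I_m => (-1) ^+ eps i *: v i)); last first.
  by move=> i _; rewrite ltn_eqF.
by rewrite -/x (le_trans hb)// lerD2r.
Qed.

End signs.

(** * Rosenthal's inequality for sums of digit functions *)

Section independent_sums.
Variable R : realType.
Implicit Types (a : nat -> R) (b d : nat) (P : R).

(* For [j] uniform below [b ^ d] the digits [digit b s j], [s < d], are independent
   and uniform, so the [xi (digit b s j)] are independent and symmetric, nonzero with
   probability [2 / b]. *)
Definition xi (w : nat) : R := if w == 0%N then 1 else if w == 1%N then -1 else 0.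

Definition digit b s j := ((j %/ b ^ s) %% b)%N.

Definition digit_sum b a d j : R := \sum_(s < d) a s * xi (digit b s j).

Lemma digit_low b s d w j : (0 < b)%N -> (s < d)%N ->
  digit b s (w * b ^ d + j) = digit b s j.
Proof.
move=> b0 sd; rewrite /digit.
have -> : (w * b ^ d = (w * b ^ (d - s.+1) * b) * b ^ s)%N.
  by rewrite -!mulnA -expnS -expnD subnK.
by rewrite divnMDl ?expn_gt0 ?b0// modnMDl.
Qed.

Lemma digit_top b d w j : (w < b)%N -> (j < b ^ d)%N ->
  digit b d (w * b ^ d + j) = w.
Proof.
move=> wb jb; rewrite /digit divnMDl ?(leq_ltn_trans _ jb)//.
by rewrite divn_small// addn0 modn_small.
Qed.

Lemma digit_sumS b a d w j : (w < b)%N -> (j < b ^ d)%N ->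
  digit_sum b a d.+1 (w * b ^ d + j) = digit_sum b a d j + a d * xi w.
Proof.
move=> wb jb; rewrite /digit_sum big_ord_recr/= digit_top//; congr (_ + _).
by apply: eq_bigr => s _; rewrite digit_low// (leq_ltn_trans _ wb).
Qed.

Lemma avg_xi b (g : R -> R) : (1 < b)%N ->
  avg b (fun w => g (xi w)) = g 0 + (g 1 + g (-1) - 2 * g 0) / b%:R.
Proof.
case: b => [|[|b]]// _; rewrite /avg !big_ord_recl/=.
rewrite (eq_bigr (fun=> g 0)); last by [].
rewrite sumr_const card_ord -[g 0 *+ b]mulr_natl /xi/= -[in RHS](add2n b) -add2n !natrD.
by field; rewrite -natrD pnatr_eq0.
Qed.

Definition digit_moment b a P d : R := avg (b ^ d) (fun j => `|digit_sum b a d j| `^ P).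

Lemma digit_moment_ge0 b a P d : 0 <= digit_moment b a P d.
Proof. by apply: avg_ge0 => *; rewrite powR_ge0. Qed.

Lemma digit_momentS b a P d : (1 < b)%N -> 0 < P ->
  digit_moment b a P d.+1 = avg (b ^ d) (fun j =>
    `|digit_sum b a d j| `^ P + 2 / b%:R *
    ((`|digit_sum b a d j + a d| `^ P + `|digit_sum b a d j - a d| `^ P) / 2
     - `|digit_sum b a d j| `^ P)).
Proof.
move=> b1 P0; have b0 : 0 < b%:R :> R by rewrite ltr0n ltnW.
rewrite /digit_moment expnS mulnC.
have -> : avg (b ^ d * b) (fun j => `|digit_sum b a d.+1 j| `^ P) =
    avg (b * b ^ d) (fun j => `|digit_sum b a d.+1 j| `^ P) by rewrite mulnC.
rewrite avg_mul.
have -> : avg b (fun i => avg (b ^ d) (fun j =>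
      `|digit_sum b a d.+1 (i * b ^ d + j)| `^ P)) =
    avg b (fun i => avg (b ^ d) (fun j =>
      `|digit_sum b a d j + a d * xi i| `^ P)).
  by apply: eq_avg => i ib; apply: eq_avg => j jb; rewrite digit_sumS.
rewrite (@avg_xi b (fun x => avg (b ^ d) (fun j =>
  `|digit_sum b a d j + a d * x| `^ P)))//.
rewrite avgD avgZ avgD.
under [in RHS](@eq_avg _ _ (fun j => (_ + _) / 2)) => j _ do rewrite mulrC.
under [in RHS](@eq_avg _ _ (fun j => - _)) => j _ do rewrite -mulN1r.
rewrite !avgZ avgD.
under [X in X + _ = _]eq_avg => j _ do rewrite mulr0 addr0.
under [X in _ + (X + _ - _) / _ = _]eq_avg => j _ do rewrite mulr1.
under [X in _ + (_ + X - _) / _ = _]eq_avg => j _ do rewrite mulrN1.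
under [X in _ + (_ + _ - 2 * X) / _ = _]eq_avg => j _ do rewrite mulr0 addr0.
by field; rewrite gt_eqF.
Qed.

Lemma digit_moment_mono b a P d : (1 < b)%N -> 2 <= P ->
  digit_moment b a P d <= digit_moment b a P d.+1.
Proof.
move=> b1 P2; rewrite digit_momentS//; last lra.
apply: ler_avg => j _; rewrite lerDl mulr_ge0//.
have := clarkson_ge (digit_sum b a d j) (a d) P2.
have := powR_ge0 `|a d| P; lra.
Qed.

(** [rosenthal_step] holds for each value of the lower digits; the moment of order [P - 2] is then
    bounded by a power of the moment of order [P]. *)
Lemma digit_moment_step b a P d : (1 < b)%N -> 2 < P ->
  digit_moment b a P d.+1 <= digit_moment b a P d + 2 / b%:R * rosenthal_const P *
    (a d ^+ 2 * digit_moment b a P d `^ (1 - 2 / P) + `|a d| `^ P).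
Proof.
move=> b1 P2; rewrite digit_momentS//; last lra.
have b0 : 0 < b%:R :> R by rewrite ltr0n ltnW.
set S := digit_sum b a d; set C := rosenthal_const P.
have C0 : 0 <= C by rewrite (le_trans _ (rosenthal_const_ge1 _))//; lra.
apply: (@le_trans _ _ (avg (b ^ d) (fun j => `|S j| `^ P + 2 / b%:R * C *
    (a d ^+ 2 * `|S j| `^ (P - 2) + `|a d| `^ P)))).
  apply: ler_avg => j _; rewrite lerD2l -[leRHS]mulrA ler_wpM2l ?divr_ge0 ?(ltW b0)//.
  by have := rosenthal_step (S j) (a d) (ltW P2); rewrite -/C; lra.
rewrite avgD avgZ avgD avgZ avg_cst ?expn_gt0 1?ltnW//.
rewrite lerD2l ler_wpM2l ?mulr_ge0 ?divr_ge0 ?(ltW b0)//.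
rewrite lerD2r ler_wpM2l ?sqr_ge0//.
have -> : 1 - 2 / P = (P - 2) / P by field; rewrite gt_eqF//; lra.
by apply: avg_powR_le; lra.
Qed.

(** The increments are added up after replacing every earlier moment by the final one, which is
    larger. The final moment thus appears on both sides; [power_absorb] later solves for it. *)
Lemma digit_moment_bound b a P d : (1 < b)%N -> 2 < P ->
  digit_moment b a P d <= 2 / b%:R * rosenthal_const P *
    ((\sum_(s < d) a s ^+ 2) * digit_moment b a P d `^ (1 - 2 / P) +
     \sum_(s < d) `|a s| `^ P).
Proof.
move=> b1 P2; have b0 : 0 < b%:R :> R by rewrite ltr0n ltnW.
have C0 : 0 <= rosenthal_const P.
  by rewrite (le_trans _ (rosenthal_const_ge1 _))//; lra.
have P0 : 0 < 2 / P by rewrite divr_gt0//; lra.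
have P1 : 2 / P < 1 by rewrite ltr_pdivrMr; lra.
suff H e : (e <= d)%N -> digit_moment b a P e <= 2 / b%:R * rosenthal_const P *
    ((\sum_(s < e) a s ^+ 2) * digit_moment b a P d `^ (1 - 2 / P) +
     \sum_(s < e) `|a s| `^ P) by exact: H.
elim: e => [_|e IH ed].
  rewrite !big_ord0 mul0r addr0 mulr0 /digit_moment /avg.
  rewrite expn0 big_ord_recl big_ord0/= /digit_sum big_ord0 normr0 powR0.
    by rewrite addr0 mul0r.
  by rewrite gt_eqF//; lra.
rewrite (le_trans (digit_moment_step _ _ _ P2))//.
rewrite !big_ord_recr/=; have {IH} := IH (ltnW ed).
set K := 2 / b%:R * _; set W := digit_moment b a P d `^ _.
set V := digit_moment b a P e `^ _.
have K0 : 0 <= K by rewrite mulr_ge0// divr_ge0// ltW.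
have mono m n : (m <= n)%N -> digit_moment b a P m <= digit_moment b a P n.
  elim: n => [|n IHn]; first by rewrite leqn0 => /eqP ->.
  rewrite leq_eqVlt => /predU1P[->//|/IHn/le_trans]; apply.
  by apply: digit_moment_mono => //; lra.
have : K * (a e ^+ 2 * V) <= K * (a e ^+ 2 * W).
  rewrite ler_wpM2l// ler_wpM2l ?sqr_ge0//.
  by rewrite ler_powR2r ?digit_moment_ge0 ?mono ?(ltnW ed)//; lra.
lra.
Qed.

(** [2 D^2] is the inverse measure of the support of one function: the leading digit is 1 with
    probability [1 / (2 D)], and the relevant digit gives a nonzero [xi] with probability [1 / D].
    So this height makes the [L_P] norm 1. *)
Definition digit_height D P : R := (2 * D ^ 2)%:R `^ P^-1.

Lemma digit_height_gt0 D P : (0 < D)%N -> 0 < digit_height D P.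
Proof. by move=> D0; rewrite powR_gt0// ltr0n muln_gt0 expn_gt0 D0. Qed.

(* The square-function and the diagonal term of Rosenthal's inequality balance
   exactly for [D ^ 2] summands, each supported on a set of measure [1 / D] *)
Lemma rosenthal_digit_sum D a P Q : (0 < D)%N -> 2 < P ->
  Q^-1 = 4^-1 + (2 * P)^-1 ->
  digit_moment (2 * D) (fun s => digit_height D P * a s) P (D ^ 2) / (2 * D)%:R <=
  (2 * rosenthal_const P) `^ (P / 2) *
  (\sum_(s < D ^ 2) `|a s| `^ Q) `^ (P / Q).
Proof.
move=> D0 P2 QE; set H := digit_height D P.
have P0 : 0 < P by lra.
have Q2 : 2 < Q.
  have Q0 : 0 < Q by rewrite -invr_gt0 QE addr_gt0// invr_gt0//; lra.
  have : (2 * P)^-1 < 4^-1 by rewrite ltf_pV2 ?posrE//; lra.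
  by move=> h; rewrite -ltf_pV2 ?posrE// QE; lra.
have QP : Q <= P.
  have : P^-1 < 2^-1 by rewrite ltf_pV2 ?posrE//; lra.
  rewrite -lef_pV2 ?posrE ?QE ?invfM//; lra.
have Q0 : 0 < Q by lra.
set d := (D ^ 2)%N; set N := \sum_(s < d) `|a s| `^ Q.
have N0 : 0 <= N by apply: sumr_ge0 => *; exact: powR_ge0.
have H0 : 0 < H by exact: digit_height_gt0.
have b1 : (1 < 2 * D)%N by rewrite mul2n -addnn -(addn1 1) leq_add.
set b := (2 * D)%N in b1 *.
have Dr : 0 < D%:R :> R by rewrite ltr0n.
have br : 0 < b%:R :> R by rewrite ltr0n muln_gt0.
have bE : b%:R = 2 * D%:R :> R by rewrite natrM.
set U := digit_moment _ _ _ _; set X := U / b%:R.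
have U0 : 0 <= U by exact: digit_moment_ge0.
have X0 : 0 <= X by rewrite divr_ge0// ltW.
set C := rosenthal_const P.
have C1 : 1 <= C by apply: rosenthal_const_ge1; lra.
have HP : H `^ P = b%:R * D%:R.
  by rewrite powRVK// -natrM /b -mulnA mulnn.
have := @digit_moment_bound b (fun s => H * a s) P d b1 P2.
rewrite -/U -/C.
have -> : \sum_(s < d) (H * a s) ^+ 2 = H ^+ 2 * \sum_(s < d) a s ^+ 2.
  by rewrite mulr_sumr; apply: eq_bigr => s _; rewrite exprMn.
have -> : \sum_(s < d) `|H * a s| `^ P = H `^ P * \sum_(s < d) `|a s| `^ P.
  rewrite mulr_sumr; apply: eq_bigr => s _.
  by rewrite normrM powRM// (gtr0_norm H0).
set A := \sum_(s < d) a s ^+ 2; set B := \sum_(s < d) `|a s| `^ P.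
have A0 : 0 <= A by apply: sumr_ge0 => *; exact: sqr_ge0.
have UX : U = b%:R * X by rewrite mulrC divfK// gt_eqF.
move=> hU; clearbody H U b.
(* Since [H ^ P = b D] and [b = 2 D], division by [b] leaves coefficient 1 at the diagonal term and
   [D^(2/P - 1)] at the square term. *)
have XE : X <= C * (B + D%:R `^ (2 / P - 1) * A * X `^ (1 - 2 / P)).
  have H2 : H ^+ 2 = (b%:R * D%:R) `^ (2 / P).
    by rewrite -HP -powRrM -powR_mulrn ?(ltW H0)//; congr (_ `^ _); field; rewrite gt_eqF.
  have E : D%:R `^ (2 / P - 1) =
      (b%:R * D%:R)^-1 * (H ^+ 2 * b%:R `^ (1 - 2 / P)).
    rewrite H2 powRM ?(ltW br) ?(ltW Dr)//.
    rewrite !powRB ?(gt_eqF br) ?(gt_eqF Dr) ?implybT//.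
    rewrite !powRr1 ?(ltW br) ?(ltW Dr)//.
    by field; rewrite !gt_eqF// powR_gt0.
  rewrite E {1}/X ler_pdivrMr//; apply: (le_trans hU).
  rewrite UX powRM ?(ltW br)// HP bE le_eqVlt; apply/orP; left; apply/eqP.
  by field; rewrite !gt_eqF.
pose Y := N `^ (P / Q).
have Y0 : 0 <= Y by exact: powR_ge0.
have BY : B <= Y by exact: sum_powR_le.
(* Hoelder over [D^2] coefficients costs [D^(2 (1 - 2/Q))]. The total exponent of [D] is
   [2/P + 1 - 4/Q], which is 0 by the choice of [Q]. *)
have AY : D%:R `^ (2 / P - 1) * A <= Y `^ (2 / P).
  have -> : Y `^ (2 / P) = N `^ (2 / Q).
    by rewrite -powRrM; congr (_ `^ _); field; rewrite !gt_eqF.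
  have h := sum_powR_sqr_le d a (ltW Q2).
  apply: (le_trans (ler_wpM2l (powR_ge0 _ _) h)).
  rewrite mulrA -[leRHS]mul1r ler_wpM2r ?powR_ge0//.
  rewrite /d natrX -powR_mulrn ?(ltW Dr)// -powRrM.
  rewrite -powRD; last by rewrite (gt_eqF Dr) implybT.
  rewrite (_ : 2 / P - 1 + _ = 0) ?powRr0//.
  by rewrite QE; field; rewrite gt_eqF.
have C0 : 0 <= C by exact: le_trans C1.
apply: (@power_absorb _ C P X Y) => //.
apply: (le_trans XE); rewrite ler_wpM2l//.
by rewrite lerD// ler_wpM2r ?powR_ge0.
Qed.

End independent_sums.

(** * Martingale sums of signed dyadic blocks *)

Section martingale_sums.
Variable R : realType.
Implicit Types (a : nat -> nat -> R) (N j : nat) (q : R).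

(* For [j < 4 ^ n.+1] the parity of [j] is a sign independent of [j %/ 4]. *)
Definition block_value q n (c : nat -> R) j : R :=
  (4 ^ n)%:R `^ q^-1 * (-1) ^+ odd j * c (j %/ 4)%N.

Fixpoint martingale q a N j : R :=
  if N is N'.+1 then martingale q a N' (j %/ 4)%N + block_value q N' (a N') j
  else 0.

(** For a fixed quotient [j %/ 4] the earlier sum is constant and the new term takes each sign on
    two of the four children, so [clarkson_le] adds only its [q]-th power. The height
    [(4 ^ N) ^ (1/q)] turns the average of these powers into a sum. *)
Lemma martingale_le q a N : 0 < q -> q <= 2 ->
  avg (4 ^ N) (fun j => `|martingale q a N j| `^ q) <=
  \sum_(n < N) \sum_(s < 4 ^ n) `|a n s| `^ q.
Proof.
move=> q0 q2; elim: N => [|N IH].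
  by rewrite big_ord0 /avg expn0 big_ord1/= normr0 powR0 ?mul0r// gt_eqF.
rewrite big_ord_recr/= expnSr avg_mul.
set G := (4 ^ N)%:R `^ q^-1.
apply: (@le_trans _ _ (avg (4 ^ N) (fun i => `|martingale q a N i| `^ q +
   (4 ^ N)%:R * `|a N i| `^ q))).
  apply: ler_avg => i _.
  rewrite /avg !big_ord_recl big_ord0 /= /block_value !divnMDl//=.
  rewrite !divn_small// addn0 !oddD !oddM/= andbF /=.
  rewrite /bump/= !expr1 !expr0 !mulr1 addr0 -/G mulrN1 mulNr.
  have := clarkson_le (martingale q a N i) (G * a N i) q0 q2.
  rewrite normrM powRM// (ger0_norm (powR_ge0 _ _)) powRVK//.
  by set x := `|_ + _| `^ _; set y := `|_ - _| `^ _; lra.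
by rewrite avgD avgZ lerD// /avg mulrC divfK.
Qed.

End martingale_sums.

(** * The spaces L_p and ell_p *)

Section Lspace_class.
Context d (T : measurableType d) (R : realType).
Variable mu : {measure set T -> \bar R}.
Variables (p : \bar R) (p1 : (1 <= p)%E).

Local Notation Lsp := (LspaceType mu p1).

(** Total, with default value 0 outside [L_p], so that classes can be formed first and membership
    proved where it matters. *)
Definition Lclass (g : T -> R) : Lsp :=
  if pselect (g \in Lfun mu p) is left gP then Lspace_of (Lfun_Sub p1 gP) else 0.

Lemma LclassE g : g \in Lfun mu p -> (Lclass g : T -> R) = g %[ae mu].
Proof.
move=> gP; rewrite /Lclass; case: pselect => // gP'.
exact: Lspace_ofE.
Qed.

Lemma Lspace_DE (f g : Lsp) : ((f + g : Lsp) : T -> R) = (f : T -> R) \+ g %[ae mu].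
Proof. exact: Lspace_addE. Qed.

Lemma Lspace_ZE a (f : Lsp) : ((a *: f : Lsp) : T -> R) = a \*: (f : T -> R) %[ae mu].
Proof. exact: Lspace_scaleE. Qed.

Lemma Lspace_BE (f g : Lsp) : ((f - g : Lsp) : T -> R) = (f : T -> R) \- g %[ae mu].
Proof.
have := Lspace_DE f (- g); have := Lspace_oppE g.
by apply: filterS2 => x /(_ I)/= E1 /(_ I)/= E2 _; rewrite E2 E1.
Qed.

Lemma LclassD f g : f \in Lfun mu p -> g \in Lfun mu p ->
  Lclass (f \+ g) = Lclass f + Lclass g.
Proof.
move=> fP gP; have fgP : f \+ g \in Lfun mu p.
  exact: (LfunP (Lfun_Sub p1 fP + Lfun_Sub p1 gP)).
apply/LspaceP; have := Lspace_DE (Lclass f) (Lclass g); have := LclassE fgP.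
have := LclassE fP; have := LclassE gP.
move=> h1 h2 h3 h4; apply: filterS2 (filterI h1 h2) (filterI h3 h4).
move=> x [/(_ I)/= E1 /(_ I)/= E2] [/(_ I)/= E3 /(_ I)/= E4] _.
by rewrite E3 E4 E1 E2.
Qed.

Lemma LclassZ a f : f \in Lfun mu p -> Lclass (a \*: f) = a *: Lclass f.
Proof.
move=> fP; have afP : a \*: f \in Lfun mu p.
  exact: (LfunP (a *: Lfun_Sub p1 fP)).
apply/LspaceP; have := Lspace_ZE a (Lclass f); have := LclassE afP.
have := LclassE fP.
by apply: filterS3 => x /(_ I)/= E1 /(_ I)/= E2 /(_ I)/= E3 _; rewrite E3 E2 E1.
Qed.

End Lspace_class.

Section Lspace_norm_power.
Context d (T : measurableType d) (R : realType).
Variable mu : {measure set T -> \bar R}.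
Variables (p : R) (p1 : (1 <= p%:E)%E).

Local Notation Lsp := (LspaceType mu p1).

Let p0 : 0 < p.
Proof. by rewrite (lt_le_trans ltr01)// -lee_fin. Qed.

Lemma normr_Lspace_powR (f : Lsp) :
  ((`|f| `^ p)%:E = \int[mu]_x (`|(f : T -> R) x| `^ p)%:E)%E.
Proof. by rewrite -poweR_EFin normr_LspaceE poweR_Lnorm ?gt_eqF. Qed.

Lemma measurable_powR_norm (f : T -> R) : measurable_fun setT f ->
  measurable_fun setT (fun x => (`|f x| `^ p)%:E).
Proof.
move=> mf; apply/measurable_EFinP.
apply: (@measurableT_comp _ _ _ _ _ _ (@powR R ^~ p)) => //.
exact: measurableT_comp.
Qed.

Lemma Lfun_powR (g : T -> R) : measurable_fun setT g ->
  (\int[mu]_x (`|g x| `^ p)%:E < +oo)%E -> g \in Lfun mu p%:E.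
Proof.
move=> mg ig; rewrite inE; apply/andP; split; rewrite inE//=.
by rewrite /finite_norm unlock poweR_lty.
Qed.

Lemma Lfun_meas (g : T -> R) : g \in Lfun mu p%:E -> measurable_fun setT g.
Proof. by rewrite inE => /andP[/[!inE]]. Qed.

Lemma normr_Lclass_powR (g : T -> R) : g \in Lfun mu p%:E ->
  ((`|Lclass mu p1 g| `^ p)%:E = \int[mu]_x (`|g x| `^ p)%:E)%E.
Proof.
move=> gP; rewrite normr_Lspace_powR; apply: ge0_ae_eq_integral => //.
- exact/measurable_powR_norm/Lspace_measurable.
- exact/measurable_powR_norm/Lfun_meas.
by have := LclassE p1 gP; apply: filterS => x /= /[apply] ->.
Qed.

End Lspace_norm_power.

Section ell2_parallelogram.
Variable R : realType.

(** The identity holds coordinatewise and is integrated against the counting measure. It is the only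
    Hilbert space property of [ell2] that enters the argument. *)
Lemma ell2_parallelogram (x y : ell2 R) :
  `|x + y| ^+ 2 + `|x - y| ^+ 2 = 2 * (`|x| ^+ 2 + `|y| ^+ 2).
Proof.
have N2 (z : ell2 R) : ((`|z| ^+ 2)%:E =
    \int[counting]_k ((z : nat -> R) k ^+ 2)%:E)%E.
  rewrite -powR_mulrn// (normr_Lspace_powR (p1 := lee1n 2)).
  by apply: eq_integral => k _; rewrite powR_mulrn// real_normK ?num_real.
have msq (f : nat -> R) : measurable_fun [set: nat] (fun k => (f k ^+ 2)%:E : \bar R) by [].
have sq0 (f : nat -> R) k : setT k -> (0 <= (f k ^+ 2)%:E)%E.
  by rewrite lee_fin sqr_ge0.
apply: EFin_inj; rewrite EFinD !N2 -ge0_integralD//; try exact: sq0.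
rewrite [RHS]EFinM (EFinD (`|x| ^+ 2)) !N2 -ge0_integralD//; try exact: sq0.
transitivity (\int[counting]_k (2%:E * (((x : nat -> R) k ^+ 2)%:E +
    ((y : nat -> R) k ^+ 2)%:E)))%E; last first.
  by apply: ge0_integralZl_EFin => // k _; rewrite adde_ge0// sq0.
apply: ge0_ae_eq_integral => //.
- by move=> k _; rewrite adde_ge0// sq0.
- by move=> k _; rewrite mule_ge0// adde_ge0// sq0.
have := Lspace_DE x y; have := Lspace_BE x y.
apply: filterS2 => k /(_ I)/= E1 /(_ I)/= E2 _.
by rewrite E1 E2 -!EFinD -EFinM; congr EFin; ring.
Qed.

End ell2_parallelogram.

Section ellp_unit_vectors.
Variables (R : realType) (p : R) (p1 : (1 <= p%:E)%E).

Let p0 : 0 < p.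
Proof. by rewrite (lt_le_trans ltr01)// -lee_fin. Qed.

Definition unit_seq (j : nat) : nat -> R := fun k => (k == j)%:R.

Definition unit_vector j : ellp p1 := Lclass counting p1 (unit_seq j).

Lemma series_indicator m (u : nat -> R) : (forall k, 0 <= u k) ->
  (forall k, (m <= k)%N -> u k = 0) ->
  (\sum_(0 <= k <oo) (u k)%:E = (\sum_(k < m) u k)%:E)%E.
Proof.
move=> u0 um; rewrite (nneseries_split 0 m); last by move=> k; rewrite lee_fin.
rewrite add0n eseries0; last by move=> k mk _; rewrite um.
by rewrite adde0 big_mkord sumEFin.
Qed.

Lemma integral_finitely_supported m (u : nat -> R) : (forall k, 0 <= u k) ->
  (forall k, (m <= k)%N -> u k = 0) ->
  (\int[counting]_k (u k)%:E = (\sum_(k < m) u k)%:E)%E.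
Proof.
move=> u0 um; rewrite ge0_integral_count; last by move=> k; rewrite lee_fin.
exact: series_indicator.
Qed.

Lemma finitely_supported_Lfun m (u : nat -> R) :
  (forall k, (m <= k)%N -> u k = 0) ->
  u \in Lfun (counting : {measure set nat -> \bar R}) p%:E.
Proof.
move=> um; apply: Lfun_powR => //.
rewrite (@integral_finitely_supported m) ?ltry// => k mk.
by rewrite um// normr0 powR0// gt_eqF.
Qed.

Lemma normr_unit_vector j : `|unit_vector j| = 1.
Proof.
have eP : unit_seq j \in Lfun (counting : {measure set nat -> \bar R}) p%:E.
  apply: (@finitely_supported_Lfun j.+1) => k jk.
  by rewrite /unit_seq gtn_eqF.
apply: (@powR_injective _ p) => //; rewrite ?nnegrE// powR1.
apply: EFin_inj; rewrite normr_Lclass_powR//.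
rewrite (@integral_finitely_supported j.+1).
- rewrite big_ord_recr/= big1 ?add0r.
    by rewrite /unit_seq eqxx normr1 powR1.
  by move=> k _; rewrite /unit_seq ltn_eqF// normr0 powR0// gt_eqF.
- by move=> k; rewrite powR_ge0.
- by move=> k jk; rewrite /unit_seq gtn_eqF// normr0 powR0// gt_eqF.
Qed.

(** The value does not depend on [eps], so signs chosen greedily elsewhere leave the growth rate
    [m^(1/p)] intact. *)
Lemma normr_signed_unit_vectors (eps : nat -> bool) m :
  `|\sum_(j < m) (-1) ^+ eps j *: unit_vector j| = m%:R `^ p^-1.
Proof.
pose u n k : R := if (k < n)%N then (-1) ^+ eps k else 0.
have uP n : u n \in Lfun (counting : {measure set nat -> \bar R}) p%:E.
  by apply: (@finitely_supported_Lfun n) => k nk; rewrite /u ltnNge nk.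
have eP j : unit_seq j \in Lfun (counting : {measure set nat -> \bar R}) p%:E.
  apply: (@finitely_supported_Lfun j.+1) => k jk.
  by rewrite /unit_seq gtn_eqF.
have -> : \sum_(j < m) (-1) ^+ eps j *: unit_vector j = Lclass _ p1 (u m).
  elim: m => [|m IH].
    rewrite big_ord0; apply/esym.
    have -> : Lclass counting p1 (u 0%N) = Lclass counting p1 (0 \*: u 0%N).
      by congr Lclass; apply/funext => k /=; rewrite scale0r.
    by rewrite LclassZ// scale0r.
  rewrite big_ord_recr/= IH -LclassZ// -LclassD//; last first.
    exact: (LfunP ((-1) ^+ eps m *: Lfun_Sub p1 (eP m))).
  congr Lclass; apply/funext => k; rewrite /u /unit_seq /= ltnS.
  by case: (ltngtP k m) => [km|km|->] /=;
    rewrite ?scaler0 ?addr0 ?add0r// /GRing.scale/= mulr1.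
apply: (@powR_injective _ p) => //; rewrite ?nnegrE ?powR_ge0//.
rewrite powRVK//; apply: EFin_inj; rewrite normr_Lclass_powR//.
rewrite (@integral_finitely_supported m).
- congr EFin; rewrite -[RHS]mulr1 mulr_natl -[in RHS](card_ord m) -sumr_const.
  by apply: eq_bigr => k _; rewrite /u ltn_ord normrX normrN1 expr1n powR1.
- by move=> k; rewrite powR_ge0.
- by move=> k mk; rewrite /u ltnNge mk normr0 powR0// gt_eqF.
Qed.

End ellp_unit_vectors.

(** * Dyadic step functions *)

Section step_functions.
Variable R : realType.
Implicit Types (v w : nat -> R) (M j : nat) (t : R).

Local Notation mu := (@lebesgue01 R).

Definition cell M j : set R := `[j%:R / (2 ^ M)%:R, j.+1%:R / (2 ^ M)%:R[.

(* A vector is a function on [nat] of which only the first [2 ^ M] values matter. *)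
Definition step M v t : R := \sum_(j < 2 ^ M) v j * \1_(cell M j) t.

Let pow2_gt0 M : 0 < (2 ^ M)%:R :> R.
Proof. by rewrite ltr0n expn_gt0. Qed.

Local Hint Resolve pow2_gt0 : core.

Lemma cellE M j t : 0 <= t ->
  (t \in cell M j) = (Num.truncn ((2 ^ M)%:R * t) == j).
Proof.
move=> t0; rewrite truncn_eq; last by rewrite mulr_ge0.
rewrite /cell mem_setE in_itv/= ler_pdivrMr// ltr_pdivlMr//.
by rewrite [t * _]mulrC.
Qed.

Lemma stepE M v t :
  step M v t = if (0 <= t) && (t < 1) then v (Num.truncn ((2 ^ M)%:R * t)) else 0.
Proof.
rewrite /step; have [t0|t0] /= := leP 0 t; last first.
  rewrite big1// => j _; rewrite indicE memNset ?mulr0// /cell/= in_itv/=.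
  by apply/negP; rewrite negb_and -ltNge (lt_le_trans t0).
have indE j : \1_(cell M j) t = (Num.truncn ((2 ^ M)%:R * t) == j)%:R :> R.
  by rewrite indicE cellE.
under eq_bigr do rewrite indE.
have Mt0 : 0 <= (2 ^ M)%:R * t by rewrite mulr_ge0.
have [t1|t1] := ltP t 1.
  have h : (Num.truncn ((2 ^ M)%:R * t) < 2 ^ M)%N.
    by rewrite truncn_lt_nat// -[ltRHS]mulr1 ltr_pM2l.
  rewrite (bigD1 (Ordinal h))//= eqxx mulr1 big1 ?addr0// => j.
  by rewrite -val_eqE/= eq_sym => /negPf ->; rewrite mulr0.
rewrite big1// => j _; rewrite gtn_eqF ?mulr0// (leq_trans (ltn_ord j))//.
by rewrite truncn_ge_nat// -[leLHS]mulr1 ler_pM2l.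
Qed.

Lemma step_comp M (F : R -> R) v t : F 0 = 0 -> F (step M v t) = step M (F \o v) t.
Proof. by move=> F0; rewrite !stepE; case: ifP. Qed.

Lemma step_mul M v w t : step M v t * step M w t = step M (v \* w) t.
Proof. by rewrite !stepE; case: ifP; rewrite ?mul0r. Qed.

Lemma step_add M v w : step M (v \+ w) = step M v \+ step M w.
Proof. by apply/funext => t; rewrite /= !stepE; case: ifP; rewrite ?addr0. Qed.

Lemma step_scale M c v : step M (c \*: v) = c \*: step M v.
Proof. by apply/funext => t; rewrite /= !stepE; case: ifP; rewrite ?scaler0. Qed.

Lemma step_refine M k v : step (M + k) (fun j => v (j %/ 2 ^ k)%N) = step M v.
Proof.
apply/funext => t; rewrite !stepE; case: ifP => // /andP[t0 _]; congr v.
have Mt0 n : 0 <= (2 ^ n)%:R * t by rewrite mulr_ge0.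
have /andP[h1 h2] := truncn_itv (Mt0 (M + k)%N).
apply/esym/truncn_def; rewrite -(ler_pM2r (pow2_gt0 k)) -(ltr_pM2r (pow2_gt0 k)).
have -> : (2 ^ M)%:R * t * (2 ^ k)%:R = (2 ^ (M + k))%:R * t.
  by rewrite mulrAC -natrM expnD.
rewrite -!natrM (le_trans _ h1) ?ler_nat ?leq_divM//=.
by rewrite (lt_le_trans h2)// ler_nat ltn_ceil// expn_gt0.
Qed.

Lemma measurable_step M v : measurable_fun setT (step M v).
Proof.
rewrite /step; apply: measurable_sum => j; apply: measurable_funM => //.
by apply: measurable_indic; exact: measurable_itv.
Qed.

Lemma lebesgue01_cell M j : (j < 2 ^ M)%N -> mu (cell M j) = ((2 ^ M)%:R^-1)%:E.
Proof.
move=> jM; rewrite -[LHS]/(lebesgue_measure (cell M j `&` `]0%R, 1%R[)) /cell.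
have h : (j.+1%:R / (2 ^ M)%:R <= 1 :> R) by rewrite ler_pdivrMr// mul1r ler_nat.
(* The measure lives on the open unit interval, so cell 0 loses its left endpoint; the other cells
   are unchanged. *)
have -> : `[j%:R / (2 ^ M)%:R, j.+1%:R / (2 ^ M)%:R[ `&` `]0%R, 1%R[ =
    [set` Interval (if j == 0%N then BRight 0 else BLeft (j%:R / (2 ^ M)%:R))
       (BLeft (j.+1%:R / (2 ^ M)%:R))] :> set R.
  apply/seteqP; split => t /=; case: (posnP j) => [j0|j0]; rewrite /= ?j0 !in_itv/= ?mul0r.
  - by move=> [/andP[_ ->] /andP[-> _]].
  - by move=> [].
  - rewrite j0 in h; move=> /andP[t0 t1].
    by rewrite (ltW t0) t1 t0 (lt_le_trans t1 h).
  - move=> /andP[t0 t1]; rewrite t0 t1 (lt_le_trans t1 h) andbT; split => //.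
    by rewrite (lt_le_trans _ t0)// divr_gt0// ltr0n.
rewrite lebesgue_measure_itv.
case: (posnP j) => [->|j0] /=; rewrite lte_fin.
  by rewrite divr_gt0//= oppr0 adde0 div1r.
rewrite ltr_pM2r ?invr_gt0// ltr_nat ltnSn -EFinB -mulrBl -natrB// subSnn.
by rewrite div1r.
Qed.

Lemma integral_step_ge0 M v : (forall j, (j < 2 ^ M)%N -> 0 <= v j) ->
  (\int[mu]_t (step M v t)%:E = (avg (2 ^ M) v)%:E)%E.
Proof.
move=> v0; rewrite /step /avg.
under eq_integral do rewrite -sumEFin.
rewrite ge0_integral_sum//; last 2 first.
- move=> j; apply/measurable_EFinP; apply: measurable_funM => //.
  by apply: measurable_indic; exact: measurable_itv.
- by move=> j t _; rewrite lee_fin mulr_ge0// v0.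
rewrite mulr_suml -sumEFin; apply: eq_bigr => j _.
under eq_integral do rewrite EFinM.
rewrite ge0_integralZl_EFin ?v0//; last first.
  by apply/measurable_EFinP/measurable_indic; exact: measurable_itv.
rewrite integral_indic ?setIT; last exact: measurable_itv.
  by rewrite lebesgue01_cell ?EFinM.
exact: measurableT.
Qed.

Lemma integrable_step M v : mu.-integrable setT (EFin \o step M v).
Proof.
apply/integrableP; split; first by apply/measurable_EFinP; exact: measurable_step.
have -> : (\int[mu]_t `|(EFin \o step M v) t| =
    \int[mu]_t (step M (fun j => `|v j|) t)%:E)%E.
  by apply: eq_integral => t _ /=; rewrite (step_comp _ _ _ (@normr0 _ R)).
by rewrite integral_step_ge0 ?ltry.
Qed.

Lemma integral_step M v : (\int[mu]_t (step M v t)%:E = (avg (2 ^ M) v)%:E)%E.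
Proof.
(* Write [v] as the difference of the nonnegative vectors [v + |v|] and [|v|]. *)
pose u j := v j + `|v j|.
have -> : (\int[mu]_t (step M v t)%:E =
    \int[mu]_t ((step M u t)%:E - (step M (fun j => `|v j|) t)%:E))%E.
  apply: eq_integral => t _; rewrite -EFinB; congr EFin.
  by rewrite /u !stepE; case: ifP; rewrite ?subr0//= addrK.
rewrite integralB_EFin//; try exact: integrable_step.
rewrite !integral_step_ge0//; last first.
  by move=> j _; rewrite /u; have := ler_norm (- v j); rewrite normrN; lra.
by rewrite -EFinB /u avgD addrK.
Qed.

End step_functions.

Section Lp01_steps.
Variables (R : realType) (p : R) (p1 : (1 <= p%:E)%E).
Implicit Types (v w : nat -> R) (M : nat).

Local Notation mu := (@lebesgue01 R).

Let p0 : 0 < p.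
Proof. by rewrite (lt_le_trans ltr01)// -lee_fin. Qed.

Lemma integral_step_powR M v (r : R) : 0 < r ->
  (\int[mu]_t (`|step M v t| `^ r)%:E = (avg (2 ^ M) (fun j => `|v j| `^ r))%:E)%E.
Proof.
move=> r0; rewrite -integral_step; apply: eq_integral => t _.
by rewrite (@step_comp R M (fun x => `|x| `^ r))// normr0 powR0 ?gt_eqF.
Qed.

Lemma step_Lfun M v : step M v \in Lfun mu p%:E.
Proof.
apply: Lfun_powR => //; first exact: measurable_step.
by rewrite integral_step_powR ?ltry.
Qed.

Definition stepL M v : Lp01 p1 := Lclass mu p1 (step M v).

Lemma normr_stepL M v : `|stepL M v| `^ p = avg (2 ^ M) (fun j => `|v j| `^ p).
Proof.
apply: EFin_inj; rewrite normr_Lclass_powR ?integral_step_powR//.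
exact: step_Lfun.
Qed.

Lemma stepLD M v w : stepL M (v \+ w) = stepL M v + stepL M w.
Proof. by rewrite /stepL step_add LclassD//; exact: step_Lfun. Qed.

Lemma stepLZ M c v : stepL M (c \*: v) = c *: stepL M v.
Proof. by rewrite /stepL step_scale LclassZ//; exact: step_Lfun. Qed.

Lemma stepL_sum M n (a : nat -> R) (v : nat -> nat -> R) :
  \sum_(i < n) a i *: stepL M (v i) = stepL M (fun j => \sum_(i < n) a i * v i j).
Proof.
elim: n => [|n IH].
  rewrite big_ord0 -[LHS](scale0r (stepL M (fun=> 0))) -stepLZ; congr stepL.
  by apply/funext => j /=; rewrite scale0r big_ord0.
rewrite big_ord_recr/= IH -stepLZ -stepLD; congr stepL.
by apply/funext => j; rewrite /= big_ord_recr.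
Qed.

Lemma stepL_refine M k v : stepL (M + k) (fun j => v (j %/ 2 ^ k)%N) = stepL M v.
Proof. by rewrite /stepL step_refine. Qed.

End Lp01_steps.

(** * Pairing of [L_p] with step functions *)

Section pairing.
Variables (R : realType) (p : R) (hp : 1 < p).
Implicit Types (v w : nat -> R) (M : nat).

Local Notation mu := (@lebesgue01 R).
Local Notation p1 := (exponent_ge1 hp).
Local Notation X := (Lp01 p1).

Let p0 : 0 < p. Proof. by rewrite (lt_trans ltr01). Qed.

Variables (p' : R) (p'0 : 0 < p') (pp' : p^-1 + p'^-1 = 1).

Definition pairing M v (x : X) : R := \int[mu]_t ((x : R -> R) t * step M v t).

(** The bound is on the integral of the absolute value, so that it yields both integrability and the
    continuity of [pairing]. *)
Lemma hoelder_pairing M v (x : X) :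
  (\int[mu]_t `|((x : R -> R) t * step M v t)%:E| <=
   (`|x| * (avg (2 ^ M) (fun j => `|v j| `^ p')) `^ p'^-1)%:E)%E.
Proof.
have mx : measurable_fun setT (x : R -> R).
  exact: (@Lspace_measurable _ _ _ mu _ p1 x).
have := hoelder mu mx (measurable_step M v) p0 p'0 pp'.
have -> : ('N[mu]_(p'%:E)[EFin \o step M v] =
    ((avg (2 ^ M) (fun j => `|v j| `^ p')) `^ p'^-1)%:E)%E.
  by rewrite unlock; under eq_integral do rewrite /= ; rewrite integral_step_powR.
by rewrite Lnorm1 EFinM -[X in (_ <= X * _)%E]normr_LspaceE.
Qed.

Lemma integrable_pairing M v (x : X) :
  mu.-integrable setT (EFin \o (fun t => (x : R -> R) t * step M v t)).
Proof.
apply/integrableP; split.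
  apply/measurable_EFinP/measurable_funM; last exact: measurable_step.
  exact: Lspace_measurable.
by apply: le_lt_trans (hoelder_pairing M v x) _; rewrite ltry.
Qed.

Lemma pairing_EFin M v (x : X) :
  ((pairing M v x)%:E = \int[mu]_t ((x : R -> R) t * step M v t)%:E)%E.
Proof.
rewrite /pairing /Rintegral fineK//.
exact: integrable_fin_num (integrable_pairing M v x).
Qed.

Lemma ler_pairing M v (x : X) :
  `|pairing M v x| <= `|x| * (avg (2 ^ M) (fun j => `|v j| `^ p')) `^ p'^-1.
Proof.
rewrite -lee_fin -abse_EFin pairing_EFin.
apply: le_trans (hoelder_pairing M v x).
apply: le_abse_integral => //.
by apply: measurable_int; exact: integrable_pairing.
Qed.

Lemma pairing_linear M v a (x y : X) :
  pairing M v (a *: x + y) = a * pairing M v x + pairing M v y.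
Proof.
apply: EFin_inj; rewrite EFinD EFinM !pairing_EFin -integralZl//; last first.
  exact: integrable_pairing.
rewrite -integralD//; last 2 first.
  by apply: integrableZl => //; exact: integrable_pairing.
  exact: integrable_pairing.
apply: ae_eq_integral => //.
- by apply: measurable_int; exact: integrable_pairing.
- apply: emeasurable_funD; apply: measurable_int.
    by apply: integrableZl => //; exact: integrable_pairing.
  exact: integrable_pairing.
have := Lspace_DE (a *: x) y; have := Lspace_ZE a x.
apply: filterS2 => t /(_ I) E1 /(_ I) E2 _.
rewrite [(a *: x + y : X) t]E2 [((_ : R -> R) \+ _) t]/= [(a *: x : X) t]E1.
by rewrite -EFinM -EFinD mulrDl -mulrA.
Qed.

Lemma pairing_stepL M v w : pairing M v (stepL p1 M w) = avg (2 ^ M) (w \* v).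
Proof.
apply: EFin_inj; rewrite pairing_EFin -integral_step.
apply: ae_eq_integral => //.
- by apply: measurable_int; exact: integrable_pairing.
- by apply/measurable_EFinP; exact: measurable_step.
have := LclassE p1 (step_Lfun (ltW hp : (1 <= p%:E)%E) M w).
by apply: filterS => t /(_ I)/= E _; rewrite E step_mul.
Qed.

End pairing.

(** * Completeness of [L_p] over a finite measure *)

Section completeness.
Context d (T : measurableType d) (R : realType).
Variables (mu : {measure set T -> \bar R}) (mufin : (mu setT < +oo)%E).
Variables (p : R) (hp : 1 < p).

Local Notation p1 := (exponent_ge1 hp).
Local Notation X := (LspaceType mu p1).

Let p0 : 0 < p. Proof. by rewrite (lt_trans ltr01). Qed.

Lemma cvg_normr_powR (y : nat -> R) (l : R) : y @ \oo --> l ->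
  `|y n| `^ p @[n --> \oo] --> `|l| `^ p.
Proof.
move=> /cvg_norm yl; have [l0|l0] := eqVneq `|l| 0.
  rewrite l0 in yl *; rewrite powR0 ?gt_eqF//.
  apply/cvgr0Pnorm_lt => e e0.
  have e'0 : 0 < e `^ p^-1 by rewrite powR_gt0.
  move/cvgr0Pnorm_lt : yl => /(_ _ e'0); apply: filterS => n.
  rewrite normr_id (ger0_norm (powR_ge0 _ _)) => h.
  rewrite -[ltRHS](powRVK p0 (ltW e0)).
  by apply: gt0_ltr_powR => //; rewrite nnegrE// powR_ge0.
have lp : 0 < `|l| by rewrite lt0r l0 normr_ge0.
have : derivable (@powR R ^~ p) `|l| 1.
  by apply: derivable_powR; rewrite in_itv/= lp.
move=> /derivable1_diffP/differentiable_continuous c.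
exact: (cvg_comp _ _ yl c).
Qed.

Let p' := p / (p - 1).

Let p'0 : 0 < p'. Proof. by rewrite divr_gt0// subr_gt0. Qed.

Let pp' : p^-1 + p'^-1 = 1.
Proof. by rewrite /p' invf_div; field; rewrite gt_eqF. Qed.

Section cauchy.
Variable v : nat -> X.
Hypothesis vC : forall k j, (k <= j)%N -> `|v j - v k| <= 1 / (2 ^ k.+1)%:R.

Let increment k t : \bar R :=
  `| ((v k.+1 - v k : X) : T -> R) t |%:E.

Let increment_ge0 k t : (0 <= increment k t)%E.
Proof. by rewrite lee_fin. Qed.

Let measurable_increment k : measurable_fun setT (increment k).
Proof.
apply/measurable_EFinP; apply: measurableT_comp => //.
Qed.

(** Hoelder against the constant 1, where finiteness of the measure enters, turns the geometric
    bounds on the [L_p] norms into summable [L_1] bounds. *)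
Let integral_increments :
  (\int[mu]_t (\sum_(k <oo) increment k t) < +oo)%E.
Proof.
rewrite integral_nneseries//.
pose c : R := fine (mu setT `^ p'^-1)%E.
have cE : (c%:E = mu setT `^ p'^-1)%E.
  by rewrite fineK// ge0_fin_numE ?poweR_ge0// poweR_lty.
have c0 : 0 <= c by rewrite -lee_fin cE poweR_ge0.
apply: (@le_lt_trans _ _ c%:E); last by rewrite ltry.
apply: le_trans (@epsilon_trick0 R c xpredT c0).
apply: lee_nneseries => [k _ _|k _]; first exact: integral_ge0.
have m1 : measurable_fun [set: T] (cst (1 : R)) by [].
have mk : measurable_fun setT ((v k.+1 - v k : X) : T -> R).
  exact: Lspace_measurable.
have := hoelder mu mk m1 p0 p'0 pp'.
rewrite Lnorm1; under eq_integral do rewrite /= mulr1.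
rewrite (_ : EFin \o cst (1 : R) = cst 1%E)// Lnorm_cst1 -cE.
move=> /le_trans; apply.
by rewrite -normr_LspaceE lee_fin mulrC ler_wpM2l// -[leRHS]div1r vC.
Qed.

Let ae_cvg : {ae mu, forall t, cvgn (fun k => (v k : T -> R) t)}.
Proof.
have fin : {ae mu, forall t, setT t ->
    ((fun t => \sum_(k <oo) increment k t) t \is a fin_num)%E}.
  apply: integrable_ae => //; apply/integrableP; split.
    by apply: ge0_emeasurable_sum => [k t _ _|k _]; [exact: increment_ge0|exact: measurable_increment].
  under eq_integral => t _.
    rewrite gee0_abs; last by apply: nneseries_ge0.
    over.
  exact: integral_increments.
have incr : {ae mu, forall t, forall k,
    ((v k.+1 - v k : X) : T -> R) t = (v k.+1 : T -> R) t - (v k : T -> R) t}.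
  apply: ae_foralln => k; have := Lspace_BE (v k.+1) (v k).
  by apply: filterS => t /(_ I).
move: fin incr; apply: filterS2 => t /(_ I) fint incrt.
pose w k := (v k : T -> R) t.
have -> : (fun k => (v k : T -> R) t) = (fun n => w 0%N + series (telescope w) n).
  apply/funext => n; rewrite seriesEnat/=.
  elim: n => [|n IH]; first by rewrite big_geq// addr0.
  by rewrite big_nat_recr//= addrA -IH /telescope /= subrKC.
apply: is_cvgD; first exact: is_cvg_cst.
apply: normed_cvg; apply: nondecreasing_is_cvgn.
  rewrite /normed_series_of seriesEnat; apply: nondecreasing_series => n _ _.
  exact: normr_ge0.
exists (fine (\sum_(k <oo) increment k t)%E) => _ [n _ <-].
rewrite -lee_fin fineK// /normed_series_of seriesEnat/= -sumEFin.
apply: le_trans (nneseries_lim_ge _ _); last by [].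
apply: lee_sum => k _; rewrite lee_fin /telescope/= /w.
by rewrite incrt.
Qed.

(** An upper limit is measurable without any assumption of convergence, and equals the limit almost
    everywhere. *)
Let lim_fun t : R := fine (limn_esup (fun k => ((v k : T -> R) t)%:E)).

Let measurable_lim_fun : measurable_fun setT lim_fun.
Proof.
apply: measurableT_comp => //; apply: measurable_fun_limn_esup => k.
by apply/measurable_EFinP; exact: Lspace_measurable.
Qed.

Let ae_cvg_lim_fun :
  {ae mu, forall t, (v k : T -> R) t @[k --> \oo] --> lim_fun t}.
Proof.
move: ae_cvg; apply: filterS => t ct.
have h : ((v k : T -> R) t)%:E @[k --> \oo] -->
    (limn (fun k => (v k : T -> R) t))%:E by apply: cvg_EFin => //; exact: nearW.
by rewrite /lim_fun (cvg_limn_einf_sup h).2.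
Qed.

(** Fatou's lemma for the powers of [v (k + j) - v k] as [j] grows. *)
Let integral_lim_fun k :
  (\int[mu]_t (`|((v k : T -> R) \- lim_fun) t| `^ p)%:E <=
   ((1 / (2 ^ k.+1)%:R) `^ p)%:E)%E.
Proof.
pose f j t := (`|((v (k + j)%N - v k : X) : T -> R) t| `^ p)%:E.
have mf j : measurable_fun setT (f j).
  by apply: measurable_powR_norm; exact: Lspace_measurable.
have f0 j t : setT t -> (0 <= f j t)%E by rewrite lee_fin powR_ge0.
have intf j : (\int[mu]_t f j t <= ((1 / (2 ^ k.+1)%:R) `^ p)%:E)%E.
  rewrite -(normr_Lspace_powR (v (k + j)%N - v k)) lee_fin.
  by rewrite ler_powR2r ?(ltW p0)// vC// leq_addr.
have H := fatou mu measurableT mf f0.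
have {}H : (\int[mu]_t limn_einf (f ^~ t) <= ((1 / (2 ^ k.+1)%:R) `^ p)%:E)%E.
  apply: (le_trans H); rewrite limn_einf_lim; apply: lime_le.
    exact: is_cvg_einfs.
  by apply: nearW => n; apply: ge_ereal_inf; exists (\int[mu]_t f n t)%E => //=; exists n => /=.
apply: le_trans H; rewrite le_eqVlt; apply/orP; left; apply/eqP.
apply: ge0_ae_eq_integral => //.
- apply: measurable_powR_norm; apply: measurable_funB => //.
  exact: Lspace_measurable.
- under eq_fun do rewrite /limn_einf.
  apply: measurableT_comp => //; apply: measurable_fun_limn_esup => j.
  by apply: measurableT_comp.
- move=> t _; rewrite limn_einf_lim; apply: lime_ge; first exact: is_cvg_einfs.
  by apply: nearW => n; apply: le_ereal_inf_tmp => _ [m _ <-]; exact: f0.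
have diff : {ae mu, forall t, forall j,
    ((v (k + j)%N - v k : X) : T -> R) t = (v (k + j)%N : T -> R) t - (v k : T -> R) t}.
  apply: ae_foralln => j; have := Lspace_BE (v (k + j)%N) (v k).
  by apply: filterS => t /(_ I).
move: diff ae_cvg_lim_fun; apply: filterS2 => t E c _.
have ct : f j t @[j --> \oo] --> (`|((v k : T -> R) \- lim_fun) t| `^ p)%:E.
  apply: cvg_EFin; first exact: nearW.
  rewrite (_ : fine \o _ = fun j =>
      `|(v (k + j)%N : T -> R) t - (v k : T -> R) t| `^ p); last first.
    by apply/funext => j; rewrite /f /= E.
  rewrite /= distrC; apply: cvg_normr_powR; apply: cvgB; last exact: cvg_cst.
  move: c; rewrite -(cvg_shiftn k).
  by under eq_fun do rewrite addnC.
by rewrite (cvg_limn_einf_sup ct).1.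
Qed.

Let lim_fun_diff_Lfun k : (v k : T -> R) \- lim_fun \in Lfun mu p%:E.
Proof.
apply: Lfun_powR.
  apply: measurable_funB => //; exact: Lspace_measurable.
by apply: le_lt_trans (integral_lim_fun k) _; rewrite ltry.
Qed.

Let lim_fun_Lfun : lim_fun \in Lfun mu p%:E.
Proof.
have h := LfunP (Lfun_of (v 0%N) - Lfun_Sub p1 (lim_fun_diff_Lfun 0)).
have E : lim_fun = (v 0%N : T -> R) \- ((v 0%N : T -> R) \- lim_fun).
  by apply/funext => t /=; rewrite opprB subrKC.
by rewrite E.
Qed.

Lemma fast_cauchy_cvg : exists l : X, forall k,
  `|v k - l| <= 1 / (2 ^ k.+1)%:R.
Proof.
exists (Lclass mu p1 lim_fun) => k.
have a0 : 0 <= 1 / (2 ^ k.+1)%:R :> R by rewrite divr_ge0.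
rewrite -(powRKV p0 (normr_ge0 _)) -[leRHS](powRKV p0 a0).
rewrite ler_powR2r ?invr_ge0 ?powR_ge0 ?(ltW p0)// -lee_fin normr_Lspace_powR.
apply: le_trans (integral_lim_fun k); rewrite le_eqVlt; apply/orP; left; apply/eqP.
apply: ge0_ae_eq_integral => //.
- by apply: measurable_powR_norm; exact: Lspace_measurable.
- by apply: measurable_powR_norm; exact: Lfun_meas (lim_fun_diff_Lfun k).
have := Lspace_BE (v k) (Lclass mu p1 lim_fun); have := LclassE p1 lim_fun_Lfun.
by apply: filterS2 => t /(_ I)/= E1 /(_ I)/= E2 _; rewrite E2 E1.
Qed.

End cauchy.

Lemma Lspace_complete (u : nat -> X) :
  (forall e, 0 < e -> exists N, forall m n, (N <= m)%N -> (N <= n)%N ->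
    `|u m - u n| <= e) ->
  exists l, forall e, 0 < e -> exists N, forall n, (N <= n)%N -> `|u n - l| <= e.
Proof.
move=> cu.
have e0 k : 0 < 1 / (2 ^ k.+1)%:R :> R by rewrite divr_gt0// ltr0n expn_gt0.
have /choice[phi phiP] : forall k : nat, exists N, forall m n, (N <= m)%N ->
    (N <= n)%N -> `|u m - u n| <= 1 / (2 ^ k.+1)%:R by move=> k; exact: cu.
(* Taking maxima ensures that [psi j] exceeds every threshold [phi k] with [k <= j], so [u] along
   [psi] is Cauchy at geometric speed. *)
pose psi k := (\max_(i < k.+1) phi i)%N.
have phipsi k j : (k <= j)%N -> (phi k <= psi j)%N.
  by move=> kj; exact: (leq_bigmax (Ordinal (kj : (k < j.+1)%N))).
have [k j kj|l lP] := @fast_cauchy_cvg (fun k => u (psi k)).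
  by apply: phiP; exact: phipsi.
exists l => e epos.
have [k ke] : exists k, 1 / (2 ^ k)%:R < e.
  exists (Num.truncn e^-1).+1; rewrite div1r -[ltRHS]invrK ltf_pV2 ?posrE ?invr_gt0 ?ltr0n ?expn_gt0//.
  by rewrite (lt_trans (truncnS_gt _))// ltr_nat ltn_expl.
exists (phi k) => n kn.
rewrite -(subrKA (u (psi k))) (le_trans (ler_normD _ _))//.
apply: (@le_trans _ _ (1 / (2 ^ k.+1)%:R + 1 / (2 ^ k.+1)%:R)).
  by rewrite lerD ?lP// phiP// phipsi.
apply: le_trans (ltW ke); rewrite -mulrDl expnS natrM.
by rewrite le_eqVlt; apply/orP; left; apply/eqP; field; rewrite pnatr_eq0 expn_eq0.
Qed.

End completeness.

Lemma lebesgue01_setT (R : realType) : (@lebesgue01 R setT < +oo)%E.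
Proof.
rewrite -[X in (X < _)%E]/(lebesgue_measure (setT `&` `]0%R, 1%R[ : set R)).
rewrite setTI lebesgue_measure_itv/= lte_fin ltr01.
by rewrite -EFinB ltry.
Qed.

(** * Operators of the form sum phi (x) h *)

Section series_operator.
Variables (R : realType) (X Y : normedModType R).
Hypothesis Ycomplete : forall u : nat -> Y,
  (forall e, 0 < e -> exists N, forall m n, (N <= m)%N -> (N <= n)%N ->
    `|u m - u n| <= e) ->
  exists l, forall e, 0 < e -> exists N, forall n, (N <= n)%N -> `|u n - l| <= e.
Variables (dn : nat -> nat) (phi : nat -> nat -> X -> R) (e : nat -> nat -> Y).
Hypothesis phi_linear : forall n s a x y,
  phi n s (a *: x + y) = a * phi n s x + phi n s y.
Variables (r C1 C2 : R).
Hypotheses (r0 : 0 < r) (C20 : 0 <= C2).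

Definition partial_energy N x := \sum_(n < N) \sum_(s < dn n) `|phi n s x| `^ r.

Hypothesis energy_le : forall N x, partial_energy N x <= C1 * `|x| `^ r.
Hypothesis synthesis_le : forall (a : nat -> nat -> R) N,
  `|\sum_(n < N) \sum_(s < dn n) a n s *: e n s| `^ r <=
  C2 * \sum_(n < N) \sum_(s < dn n) `|a n s| `^ r.

Let S N x := \sum_(n < N) \sum_(s < dn n) phi n s x *: e n s.

(** The [r]-th power of the norm that the coefficients of [x] would have in [ell_r]. *)
Let energy x := limn (partial_energy ^~ x).

Let energy_mono x : nondecreasing_seq (partial_energy ^~ x).
Proof.
apply/nondecreasing_seqP => n; rewrite /partial_energy big_ord_recr/= lerDl.
by apply: sumr_ge0 => *; exact: powR_ge0.
Qed.

Let energy_cvg x : cvgn (partial_energy ^~ x).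
Proof.
apply: nondecreasing_is_cvgn => //.
by exists (C1 * `|x| `^ r) => _ [n _ <-]; exact: energy_le.
Qed.

Let partial_energy_le N x : partial_energy N x <= energy x.
Proof. by apply: nondecreasing_cvgn_le. Qed.

Let energy_ub x : energy x <= C1 * `|x| `^ r.
Proof. by apply: limr_le => //; apply: nearW => n; exact: energy_le. Qed.

Let energy_ge0 x : 0 <= energy x.
Proof. by apply: le_trans (partial_energy_le 0 x); rewrite /partial_energy big_ord0. Qed.

Let S_diff N M x : (N <= M)%N ->
  `|S M x - S N x| `^ r <= C2 * (partial_energy M x - partial_energy N x).
Proof.
move=> /subnKC <-; move: (M - N)%N => k.
(* Coefficients cut off below [N], so that [synthesis_le] estimates a tail. *)
pose a n s := if (n < N)%N then 0 else phi n s x.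
have := synthesis_le a (N + k).
rewrite !big_split_ord /=.
rewrite big1 ?add0r; last first.
  by move=> n _; rewrite big1// => s _; rewrite /a ltn_ord scale0r.
rewrite [X in C2 * (X + _)]big1 ?add0r; last first.
  move=> n _; rewrite big1// => s _.
  by rewrite /a ltn_ord normr0 powR0// gt_eqF.
have aE n s : a (N + n)%N s = phi (N + n)%N s x.
  by rewrite /a ltnNge leq_addr.
have -> : S (N + k) x - S N x =
    \sum_(i < k) \sum_(s < dn (N + i)) a (N + i)%N s *: e (N + i)%N s.
  rewrite /S big_split_ord/= addrAC subrr add0r.
  by apply: eq_bigr => i _; apply: eq_bigr => s _; rewrite aE.
have -> // : partial_energy (N + k) x - partial_energy N x =
    \sum_(i < k) \sum_(s < dn (N + i)) `|a (N + i)%N s| `^ r.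
rewrite /partial_energy big_split_ord/= addrAC subrr add0r.
by apply: eq_bigr => i _; apply: eq_bigr => s _; rewrite aE.
Qed.

Let S_cauchy x eps : 0 < eps -> exists N, forall m n, (N <= m)%N -> (N <= n)%N ->
  `|S m x - S n x| <= eps.
Proof.
move=> eps0; pose eta := eps `^ r / (C2 + 1).
have C21 : 0 < C2 + 1 by rewrite ltr_wpDl.
have eta0 : 0 < eta by rewrite divr_gt0// powR_gt0.
have /cvgrPdist_lt /(_ _ eta0) [N _ HN] : partial_energy ^~ x @ \oo --> energy x.
  exact: energy_cvg.
have key m n : (N <= n)%N -> (n <= m)%N -> `|S m x - S n x| <= eps.
  move=> Nn nm; rewrite -(powRKV r0 (normr_ge0 _)) -[leRHS](powRKV r0 (ltW eps0)).
  rewrite ler_powR2r ?powR_ge0 ?invr_ge0 ?(ltW r0)//.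
  apply: (le_trans (S_diff x nm)).
  have h1 : partial_energy m x - partial_energy n x <= eta.
    have := HN n Nn; rewrite /= ger0_norm ?subr_ge0//.
    by have := partial_energy_le m x; lra.
  have h2 : C2 * (partial_energy m x - partial_energy n x) <= C2 * eta.
    by rewrite ler_wpM2l.
  have h3 : eps `^ r = (C2 + 1) * eta by rewrite mulrC divfK// gt_eqF.
  by rewrite h3; lra.
exists N => m n Nm Nn; have [nm|mn] := leqP n m; first exact: key.
by rewrite distrC key// ltnW.
Qed.

Let lim_exists x : exists l, forall eps, 0 < eps ->
  exists N, forall n, (N <= n)%N -> `|S n x - l| <= eps.
Proof. by apply: Ycomplete; exact: S_cauchy. Qed.

Let L x : Y := projT1 (cid (lim_exists x)).

Let LP x eps : 0 < eps -> exists N, forall n, (N <= n)%N -> `|S n x - L x| <= eps.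
Proof. exact: (projT2 (cid (lim_exists x))). Qed.

Let lim_uniq (u : nat -> Y) (l l' : Y) :
  (forall eps, 0 < eps -> exists N, forall n, (N <= n)%N -> `|u n - l| <= eps) ->
  (forall eps, 0 < eps -> exists N, forall n, (N <= n)%N -> `|u n - l'| <= eps) ->
  l = l'.
Proof.
move=> ul ul'; apply/eqP; rewrite -subr_eq0 -normr_le0.
apply/ler_addgt0Pr => eps eps0.
have e2 : 0 < eps / 2 by rewrite divr_gt0.
have [N HN] := ul _ e2; have [N' HN'] := ul' _ e2.
pose n := maxn N N'.
have h1 := HN n (leq_maxl _ _); have h2 := HN' n (leq_maxr _ _).
rewrite add0r -(subrKA (u n)) (le_trans (ler_normD _ _))//.
by rewrite distrC [leRHS]splitr lerD.
Qed.

Let S_linear n a x y : S n (a *: x + y) = a *: S n x + S n y.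
Proof.
rewrite /S scaler_sumr -big_split/=; apply: eq_bigr => i _.
rewrite scaler_sumr -big_split/=; apply: eq_bigr => s _.
by rewrite phi_linear scalerDl scalerA.
Qed.

Let L_linear : linear L.
Proof.
move=> a x y; apply: (lim_uniq (u := S ^~ (a *: x + y))); first exact: LP.
move=> eps eps0.
have c0 : 0 < eps / (2 * (`|a| + 1)).
  by rewrite divr_gt0// mulr_gt0// ltr_wpDl.
have e2 : 0 < eps / 2 by rewrite divr_gt0.
have [N HN] := LP x c0; have [N' HN'] := LP y e2.
exists (maxn N N') => n; rewrite geq_max => /andP[Nn N'n].
rewrite S_linear opprD addrACA -scalerBr (le_trans (ler_normD _ _))//.
rewrite [leRHS]splitr lerD ?HN'// normrZ.
have h := HN n Nn.
have a1 : 0 < `|a| + 1 by rewrite ltr_wpDl.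
apply: (@le_trans _ _ ((`|a| + 1) * (eps / (2 * (`|a| + 1))))).
  by rewrite ler_pM// lerDl.
by rewrite le_eqVlt; apply/orP; left; apply/eqP; field; rewrite gt_eqF.
Qed.

Let T : {linear X -> Y} := HB.pack_for {linear X -> Y} L
  (GRing.isLinear.Build R X Y _ L L_linear).

Let phiD n s x y : phi n s (x + y) = phi n s x + phi n s y.
Proof. by have := phi_linear n s 1 x y; rewrite scale1r mul1r. Qed.

Let phiB n s x y : phi n s (x - y) = phi n s x - phi n s y.
Proof.
by have := phi_linear n s (-1) y x; rewrite scaleN1r mulN1r !(addrC (- _)).
Qed.

(** [G] records a factorization through [ell_r]: it dominates [T], is dominated by the norm, and
    satisfies the scalar Clarkson inequality valid for [r]. The last clause evaluates [T] where only
    one level has coefficients, the partial sums being constant from there on. *)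
Lemma series_operator : exists (T : {linear X -> Y}) (G : X -> R),
  [/\ forall x, `|T x| `^ r <= C2 * G x,
      forall x, G x <= C1 * `|x| `^ r,
      r <= 2 -> forall x y, G (x + y) + G (x - y) <= 2 * (G x + G y),
      2 <= r -> forall x y, 2 * (G x + G y) <= G (x + y) + G (x - y)
    & forall x n, (forall m s, (s < dn m)%N -> m != n -> phi m s x = 0) ->
      T x = \sum_(s < dn n) phi n s x *: e n s].
Proof.
have is_cvg2 x y : cvgn (fun n => 2 * (partial_energy n x + partial_energy n y)).
  by apply: is_cvgM; [exact: is_cvg_cst|exact: is_cvgD].
exists T, energy; split.
- move=> x; have E0 : 0 <= C2 * energy x by exact: mulr_ge0.
  rewrite -[leRHS](powRVK r0 E0) ler_powR2r ?(ltW r0)//.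
  apply/ler_addgt0Pr => eps eps0; have [N HN] := LP x eps0.
  have -> : T x = S N x - (S N x - L x) by rewrite subKr.
  rewrite (le_trans (ler_normB _ _))// lerD ?HN//.
  rewrite -(powRKV r0 (normr_ge0 _)) ler_powR2r ?powR_ge0 ?invr_ge0 ?(ltW r0)//.
  apply: le_trans (synthesis_le (fun n s => phi n s x) N) _.
  by rewrite ler_wpM2l//; exact: partial_energy_le.
- exact: energy_ub.
- move=> r2 x y; rewrite /energy -limD// -limD//.
  have -> : 2 * limn ((partial_energy ^~ x) \+ (partial_energy ^~ y)) =
      limn (fun n => 2 * (partial_energy n x + partial_energy n y)).
    rewrite (_ : (fun n => 2 * (partial_energy n x + partial_energy n y)) = (fun n => partial_energy n x + partial_energy n y) \+
        (fun n => partial_energy n x + partial_energy n y)); last first.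
      by apply/funext => n /=; rewrite mulr_natl mulr2n.
    by rewrite [RHS]limD ?mulr_natl ?mulr2n//; exact: is_cvgD.
  apply: ler_lim; [exact: is_cvgD|exact: is_cvg2|].
  apply: nearW => n.
  rewrite -[leLHS]/(partial_energy n (x + y) + partial_energy n (x - y)).
  rewrite /partial_energy -!big_split mulr_sumr/=.
  apply: ler_sum => i _; rewrite -!big_split mulr_sumr/=.
  by apply: ler_sum => s _; rewrite phiD phiB clarkson_le.
- move=> r2 x y; rewrite /energy -limD// -limD//.
  have -> : 2 * limn ((partial_energy ^~ x) \+ (partial_energy ^~ y)) =
      limn (fun n => 2 * (partial_energy n x + partial_energy n y)).
    rewrite (_ : (fun n => 2 * (partial_energy n x + partial_energy n y)) = (fun n => partial_energy n x + partial_energy n y) \+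
        (fun n => partial_energy n x + partial_energy n y)); last first.
      by apply/funext => n /=; rewrite mulr_natl mulr2n.
    by rewrite [RHS]limD ?mulr_natl ?mulr2n//; exact: is_cvgD.
  apply: ler_lim; [exact: is_cvg2|exact: is_cvgD|].
  apply: nearW => n.
  rewrite -[leRHS]/(partial_energy n (x + y) + partial_energy n (x - y)).
  rewrite /partial_energy -!big_split mulr_sumr/=.
  apply: ler_sum => i _; rewrite -!big_split mulr_sumr/=.
  by apply: ler_sum => s _; rewrite phiD phiB clarkson_ge.
- move=> x n xn; apply: (lim_uniq (LP x)) => eps eps0.
  exists n.+1 => N nN; rewrite /S (bigD1 (Ordinal nN))//= [X in _ + X - _]big1 ?addr0.
    by rewrite subrr normr0 ltW.
  move=> i; rewrite -val_eqE/= => ni; rewrite big1// => s _.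
  by rewrite xn// scale0r.
Qed.

End series_operator.

(** * Strict singularity and closure *)

Lemma powR_unbounded (R : realType) (a B : R) : 0 < a ->
  exists2 m : nat, (0 < m)%N & B < m%:R `^ a.
Proof.
move=> a0; pose c := (`|B| + 1) `^ a^-1.
exists (Num.truncn c).+1 => //.
have B1 : 0 <= `|B| + 1 by rewrite addr_ge0.
apply: (@lt_le_trans _ _ (`|B| + 1)).
  by rewrite (le_lt_trans (ler_norm B))// ltrDl.
rewrite -[leLHS](powRVK a0 B1) ler_powR2r ?(ltW a0) ?powR_ge0//.
exact/ltW/truncnS_gt.
Qed.

Section strict_singularity.
Variables (R : realType) (X Y : normedModType R).
Variables (p : R) (p1 : (1 <= p%:E)%E) (T : {linear X -> Y}) (G : X -> R).
Variables (r C1 C2 : R).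
Hypotheses (r0 : 0 < r) (C10 : 0 <= C1) (C20 : 0 < C2).
Hypothesis T_le : forall x, `|T x| `^ r <= C2 * G x.
Hypothesis G_le : forall x, G x <= C1 * `|x| `^ r.

Let p0 : 0 < p.
Proof. by rewrite (lt_le_trans ltr01)// -lee_fin. Qed.

Let fixed_copy (Z0 : set X) (U : {linear ellp p1 -> X}) :
  isomorphism_on setT Z0 U -> isomorphism_on Z0 (T @` Z0) T ->
  exists K, [/\ 0 < K, forall x, `|U x| <= K * `|x| &
                forall x, `|x| <= K * `|T (U x)|].
Proof.
move=> [[UZ _ _] [a ha] [b hb]] [_ _ [c hc]].
exists (`|a| + `|b| * `|c| + 1); split.
- by rewrite ltr_wpDl// addr_ge0// mulr_ge0.
- move=> x; apply: (le_trans (ha x I)); rewrite ler_wpM2r//.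
  have := ler_norm a; have : 0 <= `|b| * `|c| by rewrite mulr_ge0.
  lra.
- move=> x; have UxZ : Z0 (U x) by apply: UZ.
  apply: (le_trans (hb x I)).
  apply: (@le_trans _ _ (`|b| * (`|c| * `|T (U x)|))).
    apply: (@le_trans _ _ (`|b| * `|U x|)); first by rewrite ler_wpM2r ?ler_norm.
    rewrite ler_wpM2l// (le_trans (hc _ UxZ))// ler_wpM2r ?ler_norm//.
  rewrite mulrA ler_wpM2r//; have := normr_ge0 a; lra.
Qed.

Let signed_image (U : {linear ellp p1 -> X}) (eps : nat -> bool) m :
  \sum_(j < m) (-1) ^+ eps j *: U (unit_vector p1 j) =
  U (\sum_(j < m) (-1) ^+ eps j *: unit_vector p1 j).
Proof. by rewrite linear_sum; apply: eq_bigr => j _; rewrite linearZ. Qed.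

(** On a fixed copy, suitable signs give [m^(r/p) <= const * G (U x) <= const * m], since [G] is
    subadditive along greedy signs. This fails for large [m] because [r / p > 1]. *)
Lemma strictly_singular_of_upper : p < r ->
  (forall x y, G (x + y) + G (x - y) <= 2 * (G x + G y)) ->
  ellp_strictly_singular p1 T.
Proof.
move=> pr GD [Z0 [_ _ [U Uiso] Tiso]].
have [K [K0 UK TK]] := fixed_copy Uiso Tiso.
have a0 : 0 < r / p - 1 by rewrite subr_gt0 ltr_pdivlMr// mul1r.
have Kr0 := powR_ge0 K r.
set B := K `^ r * (C2 * (C1 * K `^ r)).
have [m m0] := powR_unbounded B a0.
have mr : 0 < m%:R :> R by rewrite ltr0n.
apply/negP; rewrite -leNgt.
have G0 : G 0 <= 0.
  by apply: (le_trans (G_le 0)); rewrite normr0 powR0 ?mulr0// gt_eqF.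
have [eps] := exists_signs (fun j => U (unit_vector p1 j)) m G0 GD.
rewrite signed_image; set x := \sum_(j < m) (-1) ^+ eps j *: unit_vector p1 j => Gx.
have h1 : `|x| `^ r <= K `^ r * `|T (U x)| `^ r.
  by rewrite -powRM ?(ltW K0)// ler_powR2r ?(ltW r0).
have h2 : \sum_(j < m) G (U (unit_vector p1 j)) <= m%:R * (C1 * K `^ r).
  rewrite mulr_natl -[X in _ <= _ *+ X]card_ord -sumr_const.
  apply: ler_sum => j _; rewrite (le_trans (G_le _))// ler_wpM2l//.
  rewrite ler_powR2r ?(ltW r0)//.
  by have := UK (unit_vector p1 j); rewrite normr_unit_vector mulr1.
have h3 : `|x| `^ r <= B * m%:R.
  apply: (le_trans h1); rewrite /B -mulrA ler_wpM2l//.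
  apply: (le_trans (T_le _)); rewrite -mulrA ler_wpM2l ?(ltW C20)//.
  by rewrite [leRHS]mulrC (le_trans Gx).
rewrite -(ler_pM2r mr); apply: le_trans h3.
rewrite /x normr_signed_unit_vectors -powRrM -{2}(powRr1 (ltW mr)).
rewrite -powRD; last by rewrite (gt_eqF mr) implybT.
by rewrite subrK mulrC.
Qed.

(** The reverse comparison, with greedy signs for [- G]: the [m] unit vectors give [m <= const * sum
    of G (U e_j) <= const * G (U x) <= const * m^(r/p)], and now [r / p < 1]. *)
Lemma strictly_singular_of_lower : r < p ->
  (forall x y, 2 * (G x + G y) <= G (x + y) + G (x - y)) ->
  ellp_strictly_singular p1 T.
Proof.
move=> rp GD [Z0 [_ _ [U Uiso] Tiso]].
have [K [K0 UK TK]] := fixed_copy Uiso Tiso.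
have a0 : 0 < 1 - r / p by rewrite subr_gt0 ltr_pdivrMr// mul1r.
have Kr0 := powR_ge0 K r.
set B := K `^ r * (C2 * (C1 * K `^ r)).
have [m m0] := powR_unbounded B a0.
have mr : 0 < m%:R :> R by rewrite ltr0n.
apply/negP; rewrite -leNgt.
have G0 : - G 0 <= 0.
  rewrite oppr_le0 -(pmulr_rge0 _ C20).
  by apply: le_trans (T_le 0); exact: powR_ge0.
have GD' x y : - G (x + y) + - G (x - y) <= 2 * (- G x + - G y).
  by have := GD x y; lra.
have [eps] := exists_signs (fun j => U (unit_vector p1 j)) m G0 GD'.
rewrite signed_image sumrN lerN2; set x := \sum_(j < m) (-1) ^+ eps j *: unit_vector p1 j => Gx.
have xE : `|x| = m%:R `^ p^-1 by exact: normr_signed_unit_vectors.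
have h1 : m%:R <= K `^ r * (C2 * \sum_(j < m) G (U (unit_vector p1 j))).
  rewrite !mulr_sumr -[leLHS]/(1 *+ m) -[X in _ *+ X <= _]card_ord -sumr_const.
  apply: ler_sum => j _; apply: (@le_trans _ _ (K `^ r * `|T (U (unit_vector p1 j))| `^ r)).
    have := TK (unit_vector p1 j); rewrite normr_unit_vector => h.
    by rewrite -powRM ?(ltW K0)// -[leLHS](congr1 (@^~ r) (powR1 R)) ler_powR2r ?(ltW r0).
  by rewrite ler_wpM2l.
have h2 : G (U x) <= C1 * (K `^ r * m%:R `^ (r / p)).
  apply: (le_trans (G_le _)); rewrite ler_wpM2l//.
  have -> : m%:R `^ (r / p) = `|x| `^ r by rewrite xE -powRrM mulrC.
  by rewrite -powRM ?(ltW K0)// ler_powR2r ?(ltW r0).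
have h3 : m%:R <= B * m%:R `^ (r / p).
  apply: (le_trans h1); rewrite /B -!mulrA ler_wpM2l// ler_wpM2l ?(ltW C20)//.
  by rewrite (le_trans Gx).
have mp : 0 < m%:R `^ (r / p) :> R by rewrite powR_gt0.
rewrite -(ler_pM2r mp); apply: le_trans h3.
rewrite -powRD; last by rewrite (gt_eqF mr) implybT.
by rewrite subrK powRr1// ltW.
Qed.

End strict_singularity.

Section closure.
Variables (R : realType) (X Y : normedModType R).

Lemma bounded_linear_ge0 (Z W : normedModType R) (A : {linear Z -> W}) :
  bounded_linear A -> exists2 C, 0 <= C & forall x, `|A x| <= C * `|x|.
Proof.
move=> [C hC]; exists `|C| => // x.
by rewrite (le_trans (hC x))// ler_wpM2r// ler_norm.
Qed.

(** The constant [C] guarantees that the set in [opnorm] is bounded, so that its [sup] is a genuine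
    supremum. *)
Lemma opnorm_ge (F : {linear X -> Y}) (C : R) x :
  (forall x, `|F x| <= C * `|x|) -> `|F x| <= opnorm F * `|x|.
Proof.
move=> hC; have [->|x0] := eqVneq x 0; first by rewrite linear0 !normr0 mulr0.
have nx : 0 < `|x| by rewrite normr_gt0.
rewrite -ler_pdivrMr//.
have -> : `|F x| / `|x| = `|F (`|x|^-1 *: x)|.
  by rewrite linearZ normrZ ger0_norm ?invr_ge0// mulrC.
apply: ub_le_sup; last first.
  by exists (`|x|^-1 *: x) => //=; rewrite normrZ ger0_norm ?invr_ge0// mulVf// gt_eqF.
exists `|C| => _ [y y1 <-]; apply: (le_trans (hC y)).
apply: (@le_trans _ _ (`|C| * `|y|)); first by rewrite ler_wpM2r// ler_norm.
by rewrite -[leRHS]mulr1 ler_wpM2l.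
Qed.

Lemma factors_closure (T : {linear X -> Y}) (e : R) : bounded_linear T -> 0 < e ->
  opnorm_closure (@factors_through_ell2 R X Y) T ->
  exists (A : {linear X -> ell2 R}) (B : {linear ell2 R -> Y}) (a b : R),
    [/\ 0 <= a, 0 <= b, forall x, `|A x| <= a * `|x|, forall z, `|B z| <= b * `|z|
      & forall x, `|T x - B (A x)| <= e * `|x|].
Proof.
move=> Tb e0 /(_ e e0) [_ [A [B [Ab Bb ->]]] hTS].
have [t t0 ht] := bounded_linear_ge0 Tb.
have [a a0 ha] := bounded_linear_ge0 Ab; have [b b0 hb] := bounded_linear_ge0 Bb.
exists A, B, a, b; split => // x.
pose F : {linear X -> Y} := T \- (B \o A).
have FC y : `|F y| <= (t + b * a) * `|y|.
  rewrite (le_trans (ler_normB _ _))// mulrDl lerD//=.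
  by rewrite (le_trans (hb _))// -mulrA ler_wpM2l.
apply: (le_trans (opnorm_ge x FC)).
by rewrite ler_wpM2r// ltW.
Qed.

End closure.

Section step_calculus.
Variable R : realType.
Implicit Types (v w : nat -> R) (M : nat).

Local Notation mu := (@lebesgue01 R).

Lemma eq_step M v w : (forall j, (j < 2 ^ M)%N -> v j = w j) -> step M v = step M w.
Proof.
by move=> vw; apply/funext => t; apply: eq_bigr => j _; rewrite vw.
Qed.

Lemma eq_stepL p (p1 : (1 <= p%:E)%E) M v w :
  (forall j, (j < 2 ^ M)%N -> v j = w j) -> stepL p1 M v = stepL p1 M w.
Proof. by move=> /eq_step vw; rewrite /stepL vw. Qed.

Section pairing_calculus.
Variables (p p' : R) (hp : 1 < p) (p'0 : 0 < p') (pp' : p^-1 + p'^-1 = 1).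
Local Notation X := (Lp01 (exponent_ge1 hp)).

Lemma pairing_add M v w (x : X) :
  pairing M (v \+ w) x = pairing M v x + pairing M w x.
Proof.
apply: EFin_inj; rewrite EFinD !(pairing_EFin p'0 pp') -integralD//;
  try exact: (integrable_pairing p'0 pp').
by apply: eq_integral => t _; rewrite step_add /= mulrDr EFinD.
Qed.

Lemma pairing_scale M c v (x : X) : pairing M (c \*: v) x = c * pairing M v x.
Proof.
apply: EFin_inj; rewrite EFinM !(pairing_EFin p'0 pp') -integralZl//; last first.
  exact: (integrable_pairing p'0 pp').
by apply: eq_integral => t _; rewrite step_scale /= -EFinM mulrCA.
Qed.

Lemma pairing_sum M n (a : nat -> R) (v : nat -> nat -> R) (x : X) :
  \sum_(i < n) a i * pairing M (v i) x =
  pairing M (fun j => \sum_(i < n) a i * v i j) x.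
Proof.
elim: n => [|n IH].
  rewrite big_ord0 -[LHS](mul0r (pairing M (fun=> 0) x)) -pairing_scale.
  by congr (pairing M _ x); apply/funext => j /=; rewrite scale0r big_ord0.
rewrite big_ord_recr/= IH -pairing_scale -pairing_add.
by congr (pairing M _ x); apply/funext => j; rewrite /= big_ord_recr.
Qed.

Lemma pairing_refine M k v (x : X) :
  pairing (M + k) (fun j => v (j %/ 2 ^ k)%N) x = pairing M v x.
Proof. by rewrite /pairing step_refine. Qed.

Lemma pairing_disjoint M M' v w :
  (forall t, step M v t * step M' w t = 0) ->
  pairing M v (stepL (exponent_ge1 hp) M' w) = 0.
Proof.
move=> vw; apply: EFin_inj; rewrite (pairing_EFin p'0 pp') -[RHS](integral0 mu setT).
apply: ae_eq_integral => //.
- by apply: measurable_int; exact: (integrable_pairing p'0 pp').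
have := LclassE (exponent_ge1 hp) (step_Lfun (exponent_ge1 hp) M' w).
by apply: filterS => t /(_ I)/= E _; rewrite E mulrC vw.
Qed.

End pairing_calculus.

(** The levels are added up and each vector is read through a quotient of the index. One pair [M'],
    [v'] serves all exponents, so that a norm in one space and a pairing with its dual concern the
    same step function. *)
Lemma common_level N (M : nat -> nat) (v : nat -> nat -> R) :
  exists M' v', [/\ forall t, step M' v' t = \sum_(n < N) step (M n) (v n) t,
    forall p (p1 : (1 <= p%:E)%E),
      \sum_(n < N) stepL p1 (M n) (v n) = stepL p1 M' v' &
    forall p p' (hp : 1 < p), 0 < p' -> p^-1 + p'^-1 = 1 ->
      forall x : Lp01 (exponent_ge1 hp),
      \sum_(n < N) pairing (M n) (v n) x = pairing M' v' x].
Proof.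
elim: N => [|N [M' [v' [IH1 IH2 IH3]]]].
  exists 0%N, (fun=> 0); split.
  - by move=> t; rewrite big_ord0 stepE; case: ifP.
  - move=> p p1; rewrite big_ord0 -[LHS](scale0r (stepL p1 0 (fun=> 0))) -stepLZ.
    by congr stepL; apply/funext => j /=; rewrite scaler0.
  - move=> p p' hp p'0 pp' x; rewrite big_ord0 -[LHS](mul0r (pairing 0 (fun=> 0) x)).
    rewrite -(pairing_scale p'0 pp'); congr (pairing _ _ x).
    by apply/funext => j /=; rewrite scaler0.
pose w j := v' (j %/ 2 ^ M N)%N + v N (j %/ 2 ^ M')%N.
exists (M' + M N)%N, w; split.
- move=> t; rewrite big_ord_recr/= -IH1 -(step_refine M' (M N)).
  rewrite -(step_refine (M N) M') [in RHS](addnC (M N)).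
  by rewrite -[LHS]/(step (M' + M N) (_ \+ _) t) step_add.
- move=> p p1; rewrite big_ord_recr/= IH2 -(stepL_refine p1 M' (M N)).
  by rewrite -(stepL_refine p1 (M N) M') (addnC (M N)) -stepLD.
- move=> p p' hp p'0 pp' x; rewrite big_ord_recr/= (IH3 _ _ _ p'0 pp').
  rewrite -(pairing_refine M' (M N)) -(pairing_refine (M N) M') (addnC (M N)).
  by rewrite -(pairing_add p'0 pp').
Qed.

(* Hoelder duality: an upper [r']-estimate for the functions gives a lower
   [r]-estimate for their coefficient functionals *)
Lemma energy_dual (p p' r r' C : R) (hp : 1 < p) (p'1 : (1 <= p'%:E)%E)
    (dn M : nat -> nat) (g : nat -> nat -> nat -> R) :
  p^-1 + p'^-1 = 1 -> 1 < r -> r^-1 + r'^-1 = 1 -> 0 <= C ->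
  (forall (a : nat -> nat -> R) N,
    `|\sum_(n < N) \sum_(s < dn n) a n s *: stepL p'1 (M n) (g n s)| <=
    C * (\sum_(n < N) \sum_(s < dn n) `|a n s| `^ r') `^ r'^-1) ->
  forall N (x : Lp01 (exponent_ge1 hp)),
  \sum_(n < N) \sum_(s < dn n) `|pairing (M n) (g n s) x| `^ r <=
  C `^ r * `|x| `^ r.
Proof.
move=> pp' r1 rr' C0 H N x.
have p'0 : 0 < p' by rewrite (lt_le_trans ltr01)// -lee_fin.
have r0 : 0 < r by lra.
have rV : r'^-1 = 1 - r^-1 by lra.
have r'0 : 0 < r' by rewrite -invr_gt0 rV subr_gt0 invf_lt1.
pose y n s := pairing (M n) (g n s) x.
(* The extremal coefficients in Hoelder's inequality: both [|a| ^ r'] and [a * y] equal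
   [|y| ^ r]. *)
pose a n s := Num.sg (y n s) * `|y n s| `^ (r - 1).
set E := \sum_(n < N) _.
have E0 : 0 <= E.
  by apply: sumr_ge0 => n _; apply: sumr_ge0 => s _; exact: powR_ge0.
have r'E : (r - 1) * r' = r.
  have -> : r' = (1 - r^-1)^-1 by rewrite -rV invrK.
  by field; rewrite gt_eqF//= gt_eqF//; lra.
have aE n s : `|a n s| `^ r' = `|y n s| `^ r.
  have [y0|y0] := eqVneq (y n s) 0.
    by rewrite /a y0 sgr0 mul0r normr0 !powR0// gt_eqF.
  rewrite /a normrM normr_sg y0 mul1r ger0_norm ?powR_ge0//.
  by rewrite -powRrM r'E.
have ay n s : a n s * y n s = `|y n s| `^ r.
  by rewrite /a mulrAC -normrEsg mulr_powRB1.
have := H a N.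
have -> : \sum_(n < N) \sum_(s < dn n) `|a n s| `^ r' = E.
  by apply: eq_bigr => n _; apply: eq_bigr => s _; exact: aE.
under eq_bigr do rewrite stepL_sum.
have [M' [v' [_ h2 h3]]] := common_level N M (fun n j => \sum_(s < dn n) a n s * g n s j).
rewrite h2 => hE.
have EE : E = pairing M' v' x.
  rewrite -(h3 _ _ hp p'0 pp'); apply: eq_bigr => n _.
  rewrite -(pairing_sum p'0 pp'); apply: eq_bigr => s _.
  by rewrite ay.
(* [E] is the pairing of [x] with the combination having coefficients [a]; cancelling [E ^ (1/r')]
   leaves [E ^ (1/r) <= C |x|]. *)
have : E <= `|x| * (C * E `^ r'^-1).
  rewrite [leLHS]EE; apply: (le_trans (ler_norm _)).
  apply: (le_trans (ler_pairing p'0 pp' M' v' x)); rewrite ler_wpM2l//.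
  by rewrite -(normr_stepL p'1) powRKV.
have [->|En0] := eqVneq E 0; first by move=> _; rewrite mulr_ge0 ?powR_ge0.
have Ep : 0 < E by rewrite lt0r En0.
rewrite mulrA => h.
have h' : E `^ r^-1 <= `|x| * C.
  have Ep' : 0 < E `^ r'^-1 by exact: powR_gt0.
  rewrite -(ler_pM2r Ep') -powRD; last by rewrite (gt_eqF Ep) implybT.
  by rewrite rr' powRr1.
rewrite -powRM// -[leLHS](powRVK r0 E0) ler_powR2r ?powR_ge0 ?(ltW r0)//.
by rewrite mulrC.
Qed.

End step_calculus.

(** * The two systems of functions *)

Section block_system.
Variables (R : realType) (q : R).
Implicit Types (c : nat -> R) (n s j : nat).

(** Each of the [4 ^ n] intervals is cut into four cells with alternating signs, and these cells are
    exactly the intervals of the next level. *)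
Definition block_level n := (2 * n.+1)%N.

Definition block n s : nat -> R := block_value q n (fun i => (i == s)%:R).

Definition block_height n : R := (4 ^ n)%:R `^ q^-1.

Lemma block_levelE n : (2 ^ block_level n = 4 ^ n * 4)%N.
Proof. by rewrite /block_level expnM -expnSr. Qed.

Lemma block_height_ge0 n : 0 <= block_height n.
Proof. exact: powR_ge0. Qed.

Lemma sum_block n c j : (j < 2 ^ block_level n)%N ->
  \sum_(s < 4 ^ n) c s * block n s j = block_value q n c j.
Proof.
rewrite block_levelE => jn; have jn' : (j %/ 4 < 4 ^ n)%N by rewrite ltn_divLR.
rewrite (bigD1 (Ordinal jn'))//= big1 ?addr0.
  by rewrite /block /block_value eqxx mulr1 mulrC.
move=> s; rewrite -val_eqE/= => sj.
by rewrite /block /block_value eq_sym (negPf sj) !mulr0.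
Qed.

(** The signs cancel in each group of four cells, on which [u] is constant. This is the source of
    orthogonality between levels. *)
Lemma avg_block n c (u : nat -> R) :
  avg (2 ^ block_level n) (fun j => block_value q n c j * u (j %/ 4)%N) = 0.
Proof.
rewrite block_levelE avg_mul -[RHS](mul0r (avg (4 ^ n) (fun=> 0))) -avgZ.
apply: eq_avg => i _; rewrite mul0r.
rewrite /avg !big_ord_recl big_ord0 /= /block_value !divnMDl//=.
rewrite !divn_small// addn0 !oddD !oddM/= andbF /= /bump/=.
by rewrite !expr1 !expr0 !mulr1 !mulrN1 !mulNr; field.
Qed.

Lemma sqr_sign_odd j : (-1) ^+ odd j * (-1) ^+ odd j = 1 :> R.
Proof. by rewrite -expr2 sqrr_sign. Qed.

Lemma avg_block_sqr n c s : (s < 4 ^ n)%N ->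
  avg (2 ^ block_level n) (fun j => block_value q n c j * block n s j) =
  c s * (block_height n ^+ 2 / (4 ^ n)%:R).
Proof.
move=> sn; have n4 : (0 < 4 ^ n)%N by rewrite expn_gt0.
have -> : avg (2 ^ block_level n) (fun j => block_value q n c j * block n s j) =
    avg (4 ^ n * 4) (fun j =>
      (fun i => block_height n ^+ 2 * (c i * (i == s)%:R)) (j %/ 4)%N).
  rewrite block_levelE; apply: eq_avg => j _.
  rewrite /block /block_value -/(block_height n).
  transitivity (block_height n ^+ 2 * (c (j %/ 4)%N * (j %/ 4 == s)%N%:R) *
    ((-1) ^+ odd j * (-1) ^+ odd j)); first by ring.
  by rewrite sqr_sign_odd mulr1.
rewrite (@avg_divn _ (4 ^ n) 4 (fun i => block_height n ^+ 2 * (c i * (i == s)%:R)))//.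
rewrite avgZ /avg (bigD1 (Ordinal sn))//= big1 ?addr0.
  by rewrite eqxx mulr1 mulrCA.
by move=> i; rewrite -val_eqE/= => /negPf ->; rewrite mulr0.
Qed.

Section block_norms.
Variables (p : R) (p1 : (1 <= p%:E)%E).

Let p0 : 0 < p.
Proof. by rewrite (lt_le_trans ltr01)// -lee_fin. Qed.

Lemma block_combination n c :
  \sum_(s < 4 ^ n) c s *: stepL p1 (block_level n) (block n s) =
  stepL p1 (block_level n) (block_value q n c).
Proof. by rewrite stepL_sum; apply: eq_stepL => j /sum_block ->. Qed.

(** The modulus is constant on the unit interval, so the norm is the same for every exponent. *)
Lemma normr_block_signs n c : (forall s, `|c s| = 1) ->
  `|stepL p1 (block_level n) (block_value q n c)| = block_height n.
Proof.
move=> c1; apply: (@powR_injective _ p) => //; rewrite ?nnegrE ?block_height_ge0//.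
rewrite normr_stepL -[RHS](avg_cst (n := 2 ^ block_level n)) ?expn_gt0//.
apply: eq_avg => j _; rewrite /block_value -/(block_height n) !normrM c1 mulr1.
by rewrite normrX normrN1 expr1n mulr1 ger0_norm ?block_height_ge0.
Qed.

(** The sum is the step function of [martingale], and over a probability space the [L_p] norm is at
    most the [L_q] norm. *)
Lemma block_synthesis (a : nat -> nat -> R) N : p <= q -> q <= 2 ->
  `|\sum_(n < N) \sum_(s < 4 ^ n) a n s *: stepL p1 (block_level n) (block n s)| <=
  (\sum_(n < N) \sum_(s < 4 ^ n) `|a n s| `^ q) `^ q^-1.
Proof.
move=> pq q2; have q0 : 0 < q by rewrite (lt_le_trans p0).
have -> : \sum_(n < N) \sum_(s < 4 ^ n) a n s *: stepL p1 (block_level n) (block n s)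
    = stepL p1 (2 * N) (martingale q a N).
  elim: N => [|N IH].
    by rewrite big_ord0 -[LHS](scale0r (stepL p1 0 (fun=> 0))) -stepLZ;
      congr stepL; apply/funext => j /=; rewrite scaler0.
  rewrite big_ord_recr/= IH block_combination.
  rewrite -(stepL_refine p1 (2 * N) 2) (_ : (2 * N + 2 = block_level N)%N).
    by rewrite -stepLD.
  by rewrite /block_level mulnSr.
rewrite -(powRKV p0 (normr_ge0 _)) normr_stepL.
have A0 r : 0 <= avg (2 ^ (2 * N)) (fun j => `|martingale q a N j| `^ r).
  by apply: avg_ge0 => *; exact: powR_ge0.
apply: (@le_trans _ _ ((avg (2 ^ (2 * N)) (fun j => `|martingale q a N j| `^ q)) `^ q^-1)).
  have := ler_powR2r (_ : 0 <= p^-1) (A0 p) (avg_powR_le _ _ p0 pq).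
  rewrite invr_ge0 (ltW p0) => /(_ isT) /le_trans; apply.
  rewrite -powRrM (_ : p / q * p^-1 = q^-1)//.
  by field; rewrite !gt_eqF.
rewrite ler_powR2r ?invr_ge0 ?(ltW q0)// (_ : (2 ^ (2 * N) = 4 ^ N)%N).
  exact: martingale_le.
by rewrite expnM.
Qed.

End block_norms.

(** For different levels the coarser vector is refined to the finer level, where it depends on
    [j %/ 4] only and [avg_block] applies. *)
Lemma pairing_block (p p' : R) (hp : 1 < p) m n s c : 0 < p' -> p^-1 + p'^-1 = 1 ->
  (s < 4 ^ m)%N ->
  pairing (block_level m) (block m s)
    (stepL (exponent_ge1 hp) (block_level n) (block_value q n c)) =
  if m == n then c s * (block_height n ^+ 2 / (4 ^ n)%:R) else 0.
Proof.
move=> p'0 pp' sm; have lvl k i : (block_level (i + k.+1) = block_level i + (2 * k.+1))%N.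
  by rewrite /block_level -mulnDr addSn.
have div4 k j : (j %/ 2 ^ (2 * k.+1) = (j %/ 4) %/ 4 ^ k)%N.
  by rewrite -divnMA expnM -expnS.
case: (ltngtP m n) => [mn|nm|mn].
- rewrite -(subnKC mn) addSnnS lvl; set k := (n - m.+1)%N.
  rewrite -(pairing_refine (block_level m) (2 * k.+1)) -lvl.
  rewrite (pairing_stepL hp p'0 pp').
  under (@eq_avg _ _ (_ \* _)) => j _ do rewrite /= div4.
  exact: (avg_block _ _ (fun i => block m s (i %/ 4 ^ k)%N)).
- rewrite -(subnKC nm) addSnnS; set k := (m - n.+1)%N.
  rewrite -(stepL_refine _ (block_level n) (2 * k.+1)) -lvl.
  rewrite (pairing_stepL hp p'0 pp').
  under (@eq_avg _ _ (_ \* _)) => j _ do rewrite /= div4 mulrC.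
  exact: (avg_block _ _ (fun i => block_value q n c (i %/ 4 ^ k)%N)).
- by rewrite mn in sm *; rewrite (pairing_stepL hp p'0 pp') avg_block_sqr.
Qed.

End block_system.

Section digit_averages.
Variable R : realType.
Implicit Types (a : nat -> R) (b d s : nat).

Lemma avg_digit b d s (g : R -> R) : (0 < b)%N -> (s < d)%N ->
  avg (b ^ d) (fun j => g (xi R (digit b s j))) = avg b (fun w => g (xi R w)).
Proof.
move=> b0; elim: d => // d IH; rewrite ltnS leq_eqVlt => /predU1P[->|sd].
  rewrite expnS avg_mul; apply: eq_avg => w wb.
  rewrite -[RHS](avg_cst (n := b ^ d)) ?expn_gt0 ?b0//.
  by apply: eq_avg => j jd; rewrite digit_top.
rewrite expnS avg_mul -IH// -[RHS](avg_cst _ b0).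
by apply: eq_avg => w wb; apply: eq_avg => j jd; rewrite digit_low.
Qed.

Lemma avg_xi0 b : (1 < b)%N -> avg b (xi R) = 0.
Proof.
move=> b1; rewrite (@avg_xi R b id)// mulr0 subr0 subrr mul0r.
by rewrite addr0.
Qed.

Lemma avg_xi_sqr b : (1 < b)%N -> avg b (fun w => xi R w * xi R w) = 2 / b%:R.
Proof.
move=> b1; rewrite (@avg_xi R b (fun x => x * x))// !mulr0 mulr1 mulrNN mulr1.
by rewrite subr0 add0r.
Qed.

(** Induction on the leading digit: if it is digit [s], its square contributes and the lower sum is
    cancelled by symmetry; otherwise it averages out itself. *)
Lemma avg_digit_sum b a d s : (1 < b)%N -> (s < d)%N ->
  avg (b ^ d) (fun j => digit_sum b a d j * xi R (digit b s j)) = a s * (2 / b%:R).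
Proof.
move=> b1; have b0 : (0 < b)%N by rewrite ltnW.
elim: d => // d IH; rewrite ltnS leq_eqVlt => /predU1P[->|sd].
  rewrite expnS avg_mul.
  transitivity (avg b (fun w => avg (b ^ d) (digit_sum b a d) * xi R w +
      a d * (xi R w * xi R w))).
    apply: eq_avg => w wb.
    rewrite -[a d * _](avg_cst (n := b ^ d)) ?expn_gt0 ?b0// mulrC -avgZ -avgD.
    apply: eq_avg => j jd; rewrite digit_sumS// digit_top//; ring.
  by rewrite avgD !avgZ avg_xi0// mulr0 add0r avg_xi_sqr.
rewrite expnS avg_mul -(IH sd).
transitivity (avg b (fun w => avg (b ^ d) (fun j => digit_sum b a d j * xi R (digit b s j))
    + a d * avg (b ^ d) (fun j => xi R (digit b s j)) * xi R w)).
  apply: eq_avg => w wb; rewrite mulrAC -avgZ -avgD.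
  apply: eq_avg => j jd; rewrite digit_sumS// digit_low//; ring.
by rewrite avgD avgZ avg_xi0// mulr0 addr0 avg_cst.
Qed.

Lemma avg_digit_sum_sqr b a d : (1 < b)%N ->
  avg (b ^ d) (fun j => digit_sum b a d j ^+ 2) =
  (\sum_(s < d) a s ^+ 2) * (2 / b%:R).
Proof.
move=> b1.
have avg_sum n m (u : nat -> nat -> R) :
    avg n (fun j => \sum_(s < m) u s j) = \sum_(s < m) avg n (u s).
  by rewrite /avg exchange_big/= mulr_suml.
transitivity (avg (b ^ d) (fun j => \sum_(s < d)
    a s * (digit_sum b a d j * xi R (digit b s j)))).
  apply: eq_avg => j _; rewrite expr2 {2}/digit_sum mulr_sumr.
  by apply: eq_bigr => s _; ring.
rewrite (avg_sum _ _ (fun s j =>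
  a s * (digit_sum b a d j * xi R (digit b s j)))) mulr_suml.
apply: eq_bigr => s _.
by rewrite avgZ avg_digit_sum// expr2 mulrA.
Qed.

End digit_averages.

Lemma sum_disjoint_powR (R : realType) (r : R) (y : nat -> R) N : 0 < r ->
  (forall m n, m != n -> y m * y n = 0) ->
  `|\sum_(n < N) y n| `^ r = \sum_(n < N) `|y n| `^ r.
Proof.
move=> r0 disj; elim: N => [|N IH].
  by rewrite !big_ord0 normr0 powR0// gt_eqF.
rewrite !big_ord_recr/=; have [y0|y0] := eqVneq (y N) 0.
  by rewrite y0 addr0 IH normr0 powR0 ?addr0// gt_eqF.
have yk (k : 'I_N) : y k = 0.
  have /eqP := disj k N (negbT (ltn_eqF (ltn_ord k))).
  by rewrite mulf_eq0 (negPf y0) orbF => /eqP.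
rewrite big1; last by move=> k _; exact: yk.
by rewrite big1 ?add0r// => k _; rewrite yk normr0 powR0// gt_eqF.
Qed.

(** * The independent functions on disjoint levels *)

Section digit_system.
Variables (R : realType) (P : R).
Implicit Types (a c : nat -> R) (n s j : nat).

Definition base n := (2 * 2 ^ n)%N.

(** In binary places: one leading digit in base [2 ^ n.+1], which selects the support of the level,
    followed by [4 ^ n = D^2] digits in the same base. *)
Definition digit_level n := (n.+1 + n.+1 * 4 ^ n)%N.

Definition height n : R := digit_height (2 ^ n) P.

(* The leading digit of [j] is [1] exactly on the interval [2 ^- n.+1, 2 ^- n[ of the
   unit interval, so different levels [n] have disjoint supports. *)
Definition digit_block n s j : R :=
  if (j %/ base n ^ (4 ^ n) == 1)%N then height n * xi R (digit (base n) s j) else 0.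

Lemma base_gt1 n : (1 < base n)%N.
Proof. by rewrite /base -expnS -{1}(expn0 2) ltn_exp2l. Qed.

Let base_gt0 n : 0 < (base n)%:R :> R.
Proof. by rewrite ltr0n ltnW// base_gt1. Qed.

Lemma height_gt0 n : 0 < height n.
Proof. by rewrite digit_height_gt0// expn_gt0. Qed.

Lemma base_powE n : (base n ^ (4 ^ n) = 2 ^ (n.+1 * 4 ^ n))%N.
Proof. by rewrite /base -expnS expnM. Qed.

Lemma digit_levelE n : (2 ^ digit_level n = base n * base n ^ (4 ^ n))%N.
Proof. by rewrite /digit_level expnD base_powE /base -expnS. Qed.

(** Conditioning on the leading digit being 1, an event of probability [1 / base n]. *)
Lemma avg_top n (u : nat -> R) :
  avg (2 ^ digit_level n)
    (fun j => if (j %/ base n ^ (4 ^ n) == 1)%N then u j else 0) =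
  avg (base n ^ (4 ^ n)) (fun j => u (1 * base n ^ (4 ^ n) + j)%N) / (base n)%:R.
Proof.
rewrite digit_levelE avg_mul; set d := (base n ^ (4 ^ n))%N.
have d0 : (0 < d)%N by rewrite expn_gt0 ltnW// base_gt1.
rewrite {1}/avg (bigD1 (Ordinal (base_gt1 n)))//= big1 ?addr0.
  congr (_ / _); apply: eq_avg => j jd.
  by rewrite divnMDl// divn_small// addn0 eqxx.
move=> i; rewrite -val_eqE/= => /negPf i1.
rewrite -[RHS](avg_cst _ d0); apply: eq_avg => j jd.
by rewrite divnMDl// divn_small// addn0 i1.
Qed.

Lemma sum_digit_block n a j : \sum_(s < 4 ^ n) a s * digit_block n s j =
  if (j %/ base n ^ (4 ^ n) == 1)%N
  then digit_sum (base n) (fun s => height n * a s) (4 ^ n) j else 0.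
Proof.
rewrite /digit_block; case: ifP => _; last by rewrite big1// => s _; rewrite mulr0.
by rewrite /digit_sum; apply: eq_bigr => s _; ring.
Qed.

Lemma digit_sum_top n a j : digit_sum (base n) a (4 ^ n) (1 * base n ^ (4 ^ n) + j) =
  digit_sum (base n) a (4 ^ n) j.
Proof.
by apply: eq_bigr => s _; rewrite digit_low// ltnW// base_gt1.
Qed.

Section digit_norms.
Variables (p : R) (p1 : (1 <= p%:E)%E).

Let p0 : 0 < p.
Proof. by rewrite (lt_le_trans ltr01)// -lee_fin. Qed.

Definition digit_vector n c : Lp01 p1 :=
  stepL p1 (digit_level n) (fun j => \sum_(s < 4 ^ n) c s * digit_block n s j).

Lemma digit_combination n c :
  \sum_(s < 4 ^ n) c s *: stepL p1 (digit_level n) (digit_block n s) = digit_vector n c.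
Proof. exact: stepL_sum. Qed.

Lemma normr_digit_vector n c : `|digit_vector n c| `^ p =
  digit_moment (base n) (fun s => height n * c s) p (4 ^ n) / (base n)%:R.
Proof.
rewrite normr_stepL.
transitivity (avg (2 ^ digit_level n) (fun j => if (j %/ base n ^ (4 ^ n) == 1)%N
   then `|digit_sum (base n) (fun s => height n * c s) (4 ^ n) j| `^ p else 0)).
  apply: eq_avg => j _; rewrite sum_digit_block; case: ifP => // _.
  by rewrite normr0 powR0// gt_eqF.
rewrite avg_top; congr (_ / _); apply: eq_avg => j _.
by rewrite digit_sum_top.
Qed.

Lemma normr_digit_block n s : (s < 4 ^ n)%N ->
  `|stepL p1 (digit_level n) (digit_block n s)| =
  height n * ((base n)%:R * (2 ^ n)%:R) `^ (- p^-1).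
Proof.
move=> sn; apply: (@powR_injective _ p) => //.
- by rewrite nnegrE.
- by rewrite nnegrE mulr_ge0 ?powR_ge0// ltW// height_gt0.
rewrite normr_stepL.
transitivity (avg (2 ^ digit_level n) (fun j => if (j %/ base n ^ (4 ^ n) == 1)%N
   then `|height n * xi R (digit (base n) s j)| `^ p else 0)).
  apply: eq_avg => j _; rewrite /digit_block; case: ifP => // _.
  by rewrite normr0 powR0// gt_eqF.
rewrite avg_top.
transitivity (avg (base n) (fun w => `|height n * xi R w| `^ p) / (base n)%:R).
  congr (_ / _); rewrite -(avg_digit (fun x => `|height n * x| `^ p) (ltnW (base_gt1 n)) sn).
  by apply: eq_avg => j _; rewrite digit_low// ltnW// base_gt1.
rewrite (avg_xi (fun x => `|height n * x| `^ p) (base_gt1 n)).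
rewrite !mulr0 !mulr1 mulrN1 normrN normr0 powR0 ?gt_eqF// mulr0 subr0 add0r.
rewrite (ger0_norm (ltW (height_gt0 n))) powRM ?powR_ge0 ?(ltW (height_gt0 n))//.
rewrite -powRrM mulNr mulVf ?gt_eqF// powR_inv1; last first.
  by rewrite mulr_ge0.
have D0 : 0 < (2 ^ n)%:R :> R by rewrite ltr0n expn_gt0.
by rewrite /base natrM; field; rewrite gt_eqF.
Qed.

(** Within the support of the level the [L_p] average is bounded by the [L_2] average, and the
    variance is [D^2] terms times [H^2 / D]. *)
Lemma normr_digit_signs_le n c : p <= 2 -> (forall s, `|c s| = 1) ->
  `|digit_vector n c| <= (base n)%:R `^ (- p^-1) * (height n * (2 ^ n)%:R `^ 2^-1).
Proof.
move=> p2 c1; have D0 : 0 < (2 ^ n)%:R :> R by rewrite ltr0n expn_gt0.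
have h0 := height_gt0 n.
have R0 : 0 <= (base n)%:R `^ (- p^-1) * (height n * (2 ^ n)%:R `^ 2^-1).
  by rewrite !mulr_ge0 ?powR_ge0// ltW.
rewrite -(powRKV p0 (normr_ge0 _)) -[leRHS](powRKV p0 R0).
rewrite ler_powR2r ?invr_ge0 ?powR_ge0 ?(ltW p0)// normr_digit_vector.
rewrite powRM ?mulr_ge0 ?powR_ge0 ?(ltW h0)//.
rewrite -powRrM mulNr mulVf ?gt_eqF// powR_inv1 ?(ltW (base_gt0 n))//.
rewrite mulrC ler_wpM2l ?invr_ge0 ?(ltW (base_gt0 n))//.
rewrite /digit_moment; apply: (le_trans (avg_powR_le _ _ p0 p2)).
rewrite (@eq_avg _ _ _ (fun j =>
    digit_sum (base n) (fun s => height n * c s) (4 ^ n) j ^+ 2)); last first.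
  by move=> j _; rewrite powR_mulrn// real_normK ?num_real.
rewrite avg_digit_sum_sqr ?base_gt1//.
rewrite (eq_bigr (fun=> height n ^+ 2)); last first.
  by move=> s _; rewrite exprMn -(real_normK (num_real (c s))) c1 expr1n mulr1.
rewrite sumr_const card_ord -[height n ^+ 2 *+ _]mulr_natr.
have -> : height n ^+ 2 * (4 ^ n)%:R * (2 / (base n)%:R) =
    (height n * (2 ^ n)%:R `^ 2^-1) ^+ 2.
  rewrite exprMn -[((2 ^ n)%:R `^ 2^-1) ^+ 2]powR_mulrn ?powR_ge0//.
  rewrite powRVK// ?(ltW D0)// /base natrM.
  have -> : (4 ^ n)%:R = (2 ^ n)%:R * (2 ^ n)%:R :> R.
    by rewrite -natrM -expnMn.
  by field; rewrite gt_eqF.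
rewrite -powR_mulrn ?mulr_ge0 ?powR_ge0 ?(ltW h0)// -powRrM.
by rewrite (_ : 2%:R * (p / 2) = p)//; field.
Qed.

End digit_norms.

Let chi i : R := (i == 1%N)%:R.

Let step_top n (u : nat -> R) t : step (digit_level n)
    (fun j => if (j %/ base n ^ (4 ^ n) == 1)%N then u j else 0) t =
  step (digit_level n) u t * step n.+1 chi t.
Proof.
rewrite -(step_refine n.+1 (n.+1 * 4 ^ n)) step_mul; congr step.
apply/funext => j /=; rewrite -base_powE /chi.
by case: eqP => _; rewrite ?mulr1 ?mulr0.
Qed.

Let chi_disjoint m n t : m != n -> step m.+1 chi t * step n.+1 chi t = 0.
Proof.
wlog mn : m n / (m < n)%N.
  move=> H; rewrite neq_ltn => /orP[mn|nm]; first by rewrite H// neq_ltn mn.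
  by rewrite mulrC H// neq_ltn nm.
move=> _; rewrite !stepE; case: ifP => [/andP[t0 t1]|_]; last by rewrite mul0r.
rewrite /chi; case: (eqVneq (Num.truncn _) 1%N) => [m1|_]; last by rewrite mul0r.
case: (eqVneq (Num.truncn _) 1%N) => [n1|_]; last by rewrite mulr0.
have h k : 0 <= (2 ^ k)%:R * t by rewrite mulr_ge0.
have /andP[+ _] := truncn_itv (h m.+1); rewrite m1 => hm.
have /andP[_ +] := truncn_itv (h n.+1); rewrite n1 => hn.
have : (2 ^ m.+2)%:R * t <= (2 ^ n.+1)%:R * t.
  by rewrite ler_wpM2r// ler_nat leq_exp2l.
rewrite expnS natrM; lra.
Qed.

Lemma pairing_digit_block (p p' : R) (hp : 1 < p) m n s c : 0 < p' ->
  p^-1 + p'^-1 = 1 -> (s < 4 ^ m)%N ->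
  pairing (digit_level m) (digit_block m s) (digit_vector (exponent_ge1 hp) n c) =
  if m == n then c s * (height n ^+ 2 / ((base n)%:R * (2 ^ n)%:R)) else 0.
Proof.
move=> p'0 pp' sm; case: eqVneq => [mn|mn]; last first.
  apply: (pairing_disjoint hp p'0 pp') => t.
  rewrite (_ : (fun j => \sum_(_ < _) _) = (fun j =>
    if (j %/ base n ^ (4 ^ n) == 1)%N
    then digit_sum (base n) (fun s => height n * c s) (4 ^ n) j else 0)); last first.
    by apply/funext => j; exact: sum_digit_block.
  rewrite !step_top mulrACA chi_disjoint// mulr0.
  by [].
rewrite mn in sm *; rewrite (pairing_stepL hp p'0 pp').
transitivity (avg (2 ^ digit_level n) (fun j => if (j %/ base n ^ (4 ^ n) == 1)%N
   then height n * (digit_sum (base n) (fun s => height n * c s) (4 ^ n) j *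
     xi R (digit (base n) s j)) else 0)).
  apply: eq_avg => j _; rewrite /= sum_digit_block /digit_block.
  by case: ifP => _; rewrite ?mul0r// mulrCA.
rewrite avg_top.
rewrite (@eq_avg _ _ _ (fun j => height n *
   (digit_sum (base n) (fun s => height n * c s) (4 ^ n) j *
     xi R (digit (base n) s j)))); last first.
  by move=> j _; rewrite digit_sum_top digit_low// ltnW// base_gt1.
rewrite avgZ avg_digit_sum ?base_gt1//.
have D0 : 0 < (2 ^ n)%:R :> R by rewrite ltr0n expn_gt0.
by rewrite /base natrM; field; rewrite gt_eqF.
Qed.

(** Levels have disjoint supports, so [P]-th powers of norms add. Each level is bounded by
    [rosenthal_digit_sum], and the sum of [E n ^ (P/Q)] is at most the same power of the sum since
    [Q <= P]. *)
Lemma digit_synthesis (P1 : (1 <= P%:E)%E) (Q : R) (a : nat -> nat -> R) N :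
  2 < P -> Q^-1 = 4^-1 + (2 * P)^-1 ->
  `|\sum_(n < N) \sum_(s < 4 ^ n) a n s *: stepL P1 (digit_level n) (digit_block n s)|
  <= ((2 * rosenthal_const P) `^ (P / 2)) `^ P^-1 *
     (\sum_(n < N) \sum_(s < 4 ^ n) `|a n s| `^ Q) `^ Q^-1.
Proof.
move=> P2 QE; have P0 : 0 < P by lra.
have QP : Q <= P.
  have Q0 : 0 < Q by rewrite -invr_gt0 QE addr_gt0// invr_gt0//; lra.
  have : P^-1 < 2^-1 by rewrite ltf_pV2 ?posrE//; lra.
  by rewrite -lef_pV2 ?posrE ?QE ?invfM//; lra.
have Q0 : 0 < Q by rewrite -invr_gt0 QE addr_gt0// invr_gt0//; lra.
set K := (2 * _) `^ _; have K0 : 0 <= K by exact: powR_ge0.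
pose E n := \sum_(s < 4 ^ n) `|a n s| `^ Q.
have E0 n : 0 <= E n by apply: sumr_ge0 => s _; exact: powR_ge0.
under eq_bigr do rewrite digit_combination /digit_vector.
pose z n j := \sum_(s < 4 ^ n) a n s * digit_block n s j.
have [M' [v' [h1 h2 _]]] := common_level N digit_level z.
have -> : \sum_(n < N) stepL P1 (digit_level n) (z n) = stepL P1 M' v' by exact: h2.
have zn n : `|stepL P1 (digit_level n) (z n)| `^ P <= K * E n `^ (P / Q).
  rewrite normr_digit_vector.
  have := @rosenthal_digit_sum R (2 ^ n) (a n) P Q; rewrite expn_gt0 => /(_ isT P2 QE).
  by rewrite (_ : ((2 ^ n) ^ 2 = 4 ^ n)%N)// -expnM mulnC expnM.
have SE : `|stepL P1 M' v'| `^ P = \sum_(n < N) `|stepL P1 (digit_level n) (z n)| `^ P.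
  apply: EFin_inj; rewrite -sumEFin normr_Lclass_powR; last exact: step_Lfun.
  transitivity (\sum_(n < N) \int[@lebesgue01 R]_t
      (`|step (digit_level n) (z n) t| `^ P)%:E)%E; last first.
    by apply: eq_bigr => n _; rewrite normr_Lclass_powR//; exact: step_Lfun.
  rewrite -ge0_integral_sum//; last first.
    by move=> n; apply: measurable_powR_norm; exact: measurable_step.
  apply: eq_integral => t _; rewrite sumEFin h1; congr EFin.
  have disj m n : m != n -> step (digit_level m) (z m) t * step (digit_level n) (z n) t = 0.
    have zE k : z k = fun j => if (j %/ base k ^ (4 ^ k) == 1)%N
        then digit_sum (base k) (fun s => height k * a k s) (4 ^ k) j else 0.
      by apply/funext => j; exact: sum_digit_block.
    by move=> mn; rewrite !zE !step_top mulrACA chi_disjoint// mulr0.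
  exact: (sum_disjoint_powR (y := fun n => step (digit_level n) (z n) t)).
rewrite -(powRKV P0 (normr_ge0 _)) SE.
have -> : (\sum_(n < N) E n) `^ Q^-1 = ((\sum_(n < N) E n) `^ (P / Q)) `^ P^-1.
  by rewrite -powRrM mulrAC divff ?mul1r// gt_eqF.
rewrite -powRM ?powR_ge0// ler_powR2r ?invr_ge0 ?(ltW P0)//.
  by apply: sumr_ge0 => n _; exact: powR_ge0.
apply: (@le_trans _ _ (\sum_(n < N) K * E n `^ (P / Q))); first exact: ler_sum.
rewrite -mulr_sumr ler_wpM2l//.
have PQ : 1 <= P / Q by rewrite ler_pdivlMr// mul1r.
have := sum_powR_le N E (ltr01 : 0 < 1 :> R) PQ.
rewrite divr1; under eq_bigr do rewrite ger0_norm//.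
by under [X in _ <= X `^ _ -> _]eq_bigr do rewrite ger0_norm// powRr1//.
Qed.

End digit_system.

(** * Operators far from factoring through ell_2 *)

Section exponents.
Variables (R : realType) (P p Q q : R).
Hypotheses (P2 : 2 < P) (pP : p^-1 + P^-1 = 1).
Hypotheses (QE : Q^-1 = 4^-1 + (2 * P)^-1) (qQ : q^-1 + Q^-1 = 1).

Let P0 : 0 < P. Proof. by rewrite (lt_trans _ P2). Qed.

Let iP0 : 0 < P^-1. Proof. by rewrite invr_gt0. Qed.

Let iP2 : P^-1 < 2^-1. Proof. by rewrite ltf_pV2 ?posrE. Qed.

Let iQ : Q^-1 = 4^-1 + 2^-1 * P^-1. Proof. by rewrite QE invfM. Qed.

Lemma exponent_bounds : [/\ 1 < p, p < q, q < 2, 2 < Q & Q < P].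
Proof.
have ip : p^-1 = 1 - P^-1 by rewrite -pP addrK.
have iq : q^-1 = 1 - Q^-1 by rewrite -qQ addrK.
have p0 : 0 < p by rewrite -invr_gt0 ip; move: iP2; lra.
have Q0 : 0 < Q by rewrite -invr_gt0 iQ; move: iP0; lra.
have q0 : 0 < q by rewrite -invr_gt0 iq iQ; move: iP2; lra.
split.
- by rewrite -ltf_pV2 ?posrE// invr1 ip; move: iP0; lra.
- by rewrite -ltf_pV2 ?posrE// iq ip iQ; move: iP2; lra.
- by rewrite -ltf_pV2 ?posrE// iq iQ; move: iP2; lra.
- by rewrite -ltf_pV2 ?posrE// iQ; move: iP2; lra.
- by rewrite -ltf_pV2 ?posrE// iQ; move: iP2; lra.
Qed.

(** The pairing of one function [h] with itself. As [|h|_P = 1], it is also [|h|_p], which is the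
    content of [couplingE]. *)
Definition coupling n : R := height P n ^+ 2 / ((base n)%:R * (2 ^ n)%:R).

Let b0 n : 0 < (base n)%:R :> R.
Proof. by rewrite ltr0n ltnW// base_gt1. Qed.

Let D0 n : 0 < (2 ^ n)%:R :> R.
Proof. by rewrite ltr0n expn_gt0. Qed.

Let bD0 n : 0 < (base n)%:R * (2 ^ n)%:R :> R.
Proof. exact: mulr_gt0. Qed.

Lemma coupling_gt0 n : 0 < coupling n.
Proof. by rewrite divr_gt0// exprn_gt0// height_gt0. Qed.

Lemma heightE n : height P n = ((base n)%:R * (2 ^ n)%:R) `^ P^-1.
Proof. by rewrite /height /digit_height /base -natrM -mulnA mulnn. Qed.

Lemma couplingE n : coupling n =
  height P n * ((base n)%:R * (2 ^ n)%:R) `^ (- p^-1).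
Proof.
rewrite (_ : - p^-1 = P^-1 - 1); last by rewrite -pP; ring.
rewrite powRB ?(gt_eqF (bD0 n)) ?implybT// powRr1 ?(ltW (bD0 n))// -heightE.
by rewrite /coupling expr2 mulrA.
Qed.

Lemma block_heightE n : block_height q n = (2 ^ n)%:R `^ (2 / q).
Proof.
rewrite /block_height (_ : (4 ^ n = (2 ^ n) ^ 2)%N).
  by rewrite natrX -powR_mulrn ?(ltW (D0 n))// -powRrM.
by rewrite -expnM mulnC expnM.
Qed.

(** The right side bounds flat level sums in [L_p], the left side is the norm of their image below
    2. Their equality amounts to [2/q = 1/2 + 1/p]. *)
Lemma coupling_block_height n : coupling n * block_height q n =
  (base n)%:R `^ (- p^-1) * (height P n * (2 ^ n)%:R `^ 2^-1).
Proof.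
rewrite couplingE block_heightE powRM ?(ltW (b0 n)) ?(ltW (D0 n))//.
have -> : (2 ^ n)%:R `^ 2^-1 = (2 ^ n)%:R `^ (- p^-1) * (2 ^ n)%:R `^ (2 / q) :> R.
  rewrite -powRD; last by rewrite (gt_eqF (D0 n)) implybT.
  by congr (_ `^ _); move: pP qQ; rewrite iQ; lra.
ring.
Qed.

(** The ratio to [D = 2 ^ n] is [D^(2/q - 1)], which is unbounded because [q < 2]. *)
Lemma block_height_unbounded B : exists n, B * (2 ^ n)%:R < block_height q n.
Proof.
have [_ _ q2 _ _] := exponent_bounds.
have q0 : 0 < q.
  rewrite -invr_gt0 (_ : q^-1 = 1 - Q^-1); last by rewrite -qQ addrK.
  by rewrite iQ; move: iP2; lra.
have e0 : 0 < 2 / q - 1 by rewrite subr_gt0 ltr_pdivlMr// mul1r.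
have [n n0 hn] := powR_unbounded B e0.
exists n; rewrite block_heightE.
have -> : (2 ^ n)%:R `^ (2 / q) = (2 ^ n)%:R `^ (2 / q - 1) * (2 ^ n)%:R :> R.
  rewrite -{3}(powRr1 (ltW (D0 n))) -powRD; last by rewrite (gt_eqF (D0 n)) implybT.
  by rewrite subrK.
rewrite ltr_pM2r// (lt_le_trans hn)// ler_powR2r ?(ltW e0)//.
by rewrite ler_nat ltnW// ltn_expl.
Qed.

End exponents.

Section hilbertian_seminorms.
Variables (R : realType) (X : normedModType R) (A : {linear X -> ell2 R}).

Lemma signs_hilbert_le m (v : nat -> X) : exists eps : nat -> bool,
  `|A (\sum_(i < m) (-1) ^+ eps i *: v i)| ^+ 2 <= \sum_(i < m) `|A (v i)| ^+ 2.
Proof.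
apply: (@exists_signs _ _ (fun x => `|A x| ^+ 2)).
  by rewrite linear0 normr0 expr0n.
by move=> x y; rewrite linearD linearB ell2_parallelogram.
Qed.

Lemma signs_hilbert_ge m (v : nat -> X) : exists eps : nat -> bool,
  \sum_(i < m) `|A (v i)| ^+ 2 <= `|A (\sum_(i < m) (-1) ^+ eps i *: v i)| ^+ 2.
Proof.
have [||eps] := @exists_signs _ _ (fun x => - `|A x| ^+ 2) v m.
- by rewrite linear0 normr0 expr0n oppr0.
- move=> x y; have := ell2_parallelogram (A x) (A y).
  by rewrite -linearD -linearB; lra.
by rewrite sumrN lerN2; exists eps.
Qed.

End hilbertian_seminorms.

Lemma signE (R : realType) (eps : nat -> bool) s : `|(-1) ^+ eps s| = 1 :> R.
Proof. by rewrite normrX normrN1 expr1n. Qed.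

(** * The operator for exponents below 2 *)

Section below_two.
Variables (R : realType) (p : R) (hp : 1 < p) (p2 : p < 2).
Local Notation p1 := (exponent_ge1 hp).
Local Notation X := (Lp01 p1).

(** The obstruction is stated through the seminorm [|A x|] only, so it is insensitive to the space
    in which [T x] is measured; one operator thereby serves both parts of the theorem. *)
Lemma strictly_singular_not_hilbertian : exists T : {linear X -> X},
  [/\ bounded_linear T, ellp_strictly_singular p1 T &
    forall (A : {linear X -> ell2 R}) (a b : R),
      (forall x, `|A x| <= a * `|x|) ->
      (forall x, `|T x| <= b * `|A x| + 2^-1 * `|x|) -> False].
Proof.
pose P := p / (p - 1).
have p_gt1 := hp; have p_lt2 := p2; have p0 : 0 < p by lra.
have iPE : P^-1 = 1 - p^-1 by rewrite /P invf_div; field; rewrite gt_eqF.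
have pP : p^-1 + P^-1 = 1 by rewrite iPE; lra.
have ip1 : p^-1 < 1 by rewrite invf_lt1.
have ip2 : 2^-1 < p^-1 by rewrite ltf_pV2 ?posrE.
have P0 : 0 < P by rewrite divr_gt0// subr_gt0.
have P2 : 2 < P by rewrite -ltf_pV2 ?posrE// iPE; lra.
pose Q := (4^-1 + (2 * P)^-1)^-1.
have QE : Q^-1 = 4^-1 + (2 * P)^-1 by rewrite invrK.
pose q := (1 - Q^-1)^-1.
have qQ : q^-1 + Q^-1 = 1 by rewrite /q invrK subrK.
have [_ pq q2 Q2 QP] := exponent_bounds P2 pP QE qQ.
clearbody q Q P.
have q1 : 1 < q by lra.
have q0 : 0 < q by lra.
have P1 : (1 <= P%:E)%E by rewrite lee_fin; lra.
set K := ((2 * rosenthal_const P) `^ (P / 2)) `^ P^-1.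
have K0 : 0 <= K by exact: powR_ge0.
pose phi n s (x : X) := pairing (digit_level n) (digit_block P n s) x.
pose f n s : X := stepL p1 (block_level n) (block q n s).
have phi_lin n s a x y : phi n s (a *: x + y) = a * phi n s x + phi n s y.
  exact: (pairing_linear P0 pP).
have energy N x : partial_energy (fun n => 4 ^ n)%N phi q N x <= K `^ q * `|x| `^ q.
  apply: (energy_dual (p'1 := P1) pP q1 qQ K0 _ N x) => a M.
  exact: digit_synthesis.
have synth (a : nat -> nat -> R) N :
    `|\sum_(n < N) \sum_(s < 4 ^ n) a n s *: f n s| `^ q <=
    1 * \sum_(n < N) \sum_(s < 4 ^ n) `|a n s| `^ q.
  rewrite mul1r -[leRHS](powRVK q0); last first.
    by apply: sumr_ge0 => n _; apply: sumr_ge0 => s _; exact: powR_ge0.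
  rewrite ler_powR2r ?(ltW q0)//.
  by apply: block_synthesis; lra.
have [T [G [TG GX GU _ Tval]]] := series_operator
  (@Lspace_complete _ _ R _ (lebesgue01_setT R) p hp) phi_lin q0 ler01 energy synth.
have Tb x : `|T x| <= K * `|x|.
  apply: (@ler_powR_inv _ q) => //; first by rewrite mulr_ge0.
  by rewrite powRM// (le_trans (TG x))// mul1r GX.
exists T; split; first by exists K.
  apply: (strictly_singular_of_upper q0 _ ltr01 TG GX pq); first exact: powR_ge0.
  by apply: GU; lra.
move=> A a b Aa Tab.
pose a' := `|a|; have Aa' x : `|A x| <= a' * `|x|.
  by rewrite (le_trans (Aa x))// ler_wpM2r// ler_norm.
have a'0 : 0 <= a' by exact: normr_ge0.
(* The constant is set by the final contradiction with [k g <= |b| D a' k + k g / 2]. *)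
have [n hn] := block_height_unbounded P2 pP QE qQ (2 * (a' * `|b|)).
pose h s : X := stepL p1 (digit_level n) (digit_block P n s).
have [eps heps] := signs_hilbert_le A (4 ^ n) h.
pose x := digit_vector P p1 n (fun s => (-1) ^+ eps s).
have xE : \sum_(i < 4 ^ n) (-1) ^+ eps i *: h i = x by exact: digit_combination.
rewrite xE in heps.
set k := coupling P n; have k0 : 0 < k by exact: coupling_gt0.
set g := block_height q n in hn *.
have hk s : (s < 4 ^ n)%N -> `|h s| = k.
  by move=> sn; rewrite /h normr_digit_block// /k (couplingE pP).
have xk : `|x| <= k * g.
  rewrite /k /g (coupling_block_height pP QE qQ).
  by apply: normr_digit_signs_le => [|s]; [exact: ltW|exact: signE].
have TxE : T x = k *: stepL p1 (block_level n) (block_value q n (fun s => (-1) ^+ eps s)).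
  rewrite (Tval x n) => [|m s sm mn].
    rewrite -block_combination scaler_sumr; apply: eq_bigr => s _.
    by rewrite /phi (@pairing_digit_block R P p P hp _ n _ _ P0 pP)// eqxx scalerA mulrC.
  by rewrite /phi (@pairing_digit_block R P p P hp _ n _ _ P0 pP)// (negPf mn).
have Tx : `|T x| = k * g.
  by rewrite TxE normrZ (gtr0_norm k0) normr_block_signs// => s; exact: signE.
have D0 : 0 < (2 ^ n)%:R :> R by rewrite ltr0n expn_gt0.
have Ax : `|A x| <= (2 ^ n)%:R * (a' * k).
  have ak0 : 0 <= a' * k by exact: mulr_ge0 a'0 (ltW k0).
  have R0 : 0 <= (2 ^ n)%:R * (a' * k) by exact: mulr_ge0 (ltW D0) ak0.
  rewrite -(ler_pXn2r (ltn0Sn 1)) ?nnegrE//; apply: (le_trans heps).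
  apply: (@le_trans _ _ (\sum_(i < 4 ^ n) (a' * k) ^+ 2)).
    apply: ler_sum => i _; rewrite ler_pXn2r ?nnegrE//.
    by rewrite (le_trans (Aa' _))// hk.
  rewrite sumr_const card_ord -[_ *+ (4 ^ n)]mulr_natl [leRHS]exprMn -natrX.
  by rewrite (_ : ((2 ^ n) ^ 2 = 4 ^ n)%N)// -expnM mulnC expnM.
have := Tab x; rewrite Tx => H.
have : b * `|A x| <= `|b| * ((2 ^ n)%:R * (a' * k)).
  apply: (@le_trans _ _ (`|b| * `|A x|)); first by rewrite ler_wpM2r ?ler_norm.
  by rewrite ler_wpM2l.
have : 2 * (a' * `|b|) * (2 ^ n)%:R * k < g * k by rewrite ltr_pM2r.
move: H xk; clear; lra.
Qed.

End below_two.

(** * The operator for exponents above 2 *)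

Section above_two.
Variables (R : realType) (P : R) (hP : 1 < P) (P2 : 2 < P).
Local Notation P1 := (exponent_ge1 hP).
Local Notation X := (Lp01 P1).

Lemma strictly_singular_far_from_hilbertian : exists T : {linear X -> X},
  [/\ bounded_linear T, ellp_strictly_singular P1 T &
    forall (A : {linear X -> ell2 R}) (B : {linear ell2 R -> X}) (a b : R),
      0 <= a -> 0 <= b ->
      (forall x, `|A x| <= a * `|x|) -> (forall z, `|B z| <= b * `|z|) ->
      (forall x, `|T x - B (A x)| <= 2^-1 * `|x|) -> False].
Proof.
have P_gt1 := hP; have P_gt2 := P2; have P0 : 0 < P by lra.
pose p := P / (P - 1).
have ipE : p^-1 = 1 - P^-1 by rewrite /p invf_div; field; rewrite gt_eqF.
have pP : p^-1 + P^-1 = 1 by rewrite ipE; lra.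
have Pp : P^-1 + p^-1 = 1 by rewrite addrC.
have p0 : 0 < p by rewrite divr_gt0// subr_gt0.
pose Q := (4^-1 + (2 * P)^-1)^-1.
have QE : Q^-1 = 4^-1 + (2 * P)^-1 by rewrite invrK.
pose q := (1 - Q^-1)^-1.
have qQ : q^-1 + Q^-1 = 1 by rewrite /q invrK subrK.
have Qq : Q^-1 + q^-1 = 1 by rewrite addrC.
have [p_gt1 pq q2 Q2 QP] := exponent_bounds P2 pP QE qQ.
clearbody q Q p.
have Q1 : 1 < Q by lra.
have Q0 : 0 < Q by lra.
have p1 : (1 <= p%:E)%E by rewrite lee_fin ltW.
set K := ((2 * rosenthal_const P) `^ (P / 2)) `^ P^-1.
have K0 : 0 < K.
  rewrite !powR_gt0// mulr_gt0// (lt_le_trans ltr01)// rosenthal_const_ge1//.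
  exact: ltW.
have K'0 : 0 < K `^ Q by rewrite powR_gt0.
(* The two systems exchange roles: coefficients are taken against the blocks, and the values lie in
   the span of the digit functions. *)
pose phi n s (x : X) := pairing (block_level n) (block q n s) x.
pose h n s : X := stepL P1 (digit_level n) (digit_block P n s).
have phi_lin n s a x y : phi n s (a *: x + y) = a * phi n s x + phi n s y.
  exact: (pairing_linear p0 Pp).
have energy N x : partial_energy (fun n => 4 ^ n)%N phi Q N x <= 1 `^ Q * `|x| `^ Q.
  apply: (energy_dual (p'1 := p1) Pp Q1 Qq ler01 _ N x) => a M.
  by rewrite mul1r; apply: block_synthesis; lra.
have synth (a : nat -> nat -> R) N :
    `|\sum_(n < N) \sum_(s < 4 ^ n) a n s *: h n s| `^ Q <=
    K `^ Q * \sum_(n < N) \sum_(s < 4 ^ n) `|a n s| `^ Q.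
  set E := \sum_(n < N) \sum_(s < 4 ^ n) `|a n s| `^ Q.
  have E0 : 0 <= E.
    by apply: sumr_ge0 => n _; apply: sumr_ge0 => s _; exact: powR_ge0.
  rewrite -[E](powRVK Q0 E0) -powRM ?powR_ge0 ?(ltW K0)//.
  rewrite ler_powR2r ?(ltW Q0)//.
  exact: digit_synthesis.
clearbody K.
have [T [G [TG GX _ GL Tval]]] := series_operator
  (@Lspace_complete _ _ R _ (lebesgue01_setT R) P hP) phi_lin Q0 (ltW K'0) energy synth.
have Tb x : `|T x| <= K * `|x|.
  apply: (@ler_powR_inv _ Q) => //; first by rewrite mulr_ge0// ltW.
  rewrite powRM ?(ltW K0)// (le_trans (TG x))// ler_wpM2l ?(ltW K'0)//.
  by rewrite (le_trans (GX x))// powR1 mul1r.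
exists T; split; first by exists K.
  apply: (strictly_singular_of_lower Q0 _ K'0 TG GX QP); first exact: powR_ge0.
  by apply: GL; lra.
move=> A B a b a0 b0 Aa Bb TBA.
have [n hn] := block_height_unbounded P2 pP QE qQ (2 * (b * (a + 1))).
have A1 x : `|A x| <= (a + 1) * `|x|.
  by rewrite (le_trans (Aa x))// ler_wpM2r// lerDl.
have a1 : 0 < a + 1 by rewrite ltr_wpDl.
have D0 : 0 < (2 ^ n)%:R :> R by rewrite ltr0n expn_gt0.
have DE : (4 ^ n)%:R = (2 ^ n)%:R ^+ 2 :> R.
  by rewrite -natrX -expnM mulnC expnM.
set D : R := (2 ^ n)%:R in hn D0 DE.
pose f s : X := stepL P1 (block_level n) (block q n s).
pose z (c : nat -> R) j := \sum_(s < 4 ^ n) c s * digit_block P n s j.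
pose y (c : nat -> R) : X := stepL P1 (block_level n) (block_value q n c).
pose x (c : nat -> R) : X := digit_vector P P1 n c.
have yE (c : nat -> R) : \sum_(s < 4 ^ n) c s *: f s = y c by exact: block_combination.
have kp := coupling_gt0 P n; set k := coupling P n in kp.
set g := block_height q n in hn.
have g0 : 0 <= g by exact: block_height_ge0.
have phiy m s (c : nat -> R) : (s < 4 ^ m)%N -> phi m s (y c) =
    if m == n then c s * (g ^+ 2 / D ^+ 2) else 0.
  by move=> sm; rewrite /phi (@pairing_block R q P p hP m n s c p0 Pp sm) DE.
set w := g ^+ 2 / D ^+ 2 in phiy.
have w0 : 0 <= w by rewrite divr_ge0 ?sqr_ge0.
have Ty c : T (y c) = w *: x c.
  rewrite (Tval (y c) n) => [|m s sm mn]; last by rewrite phiy// (negPf mn).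
  rewrite /x -digit_combination scaler_sumr; apply: eq_bigr => s _.
  by rewrite phiy// eqxx scalerA mulrC.
have pairx (c : nat -> R) s : (s < 4 ^ n)%N ->
    pairing (digit_level n) (digit_block P n s) (x c) = c s * k.
  by move=> sn; rewrite (@pairing_digit_block R P P p hP n n s c p0 Pp sn) eqxx.
pose psi (c : nat -> R) v : R := pairing (digit_level n) (z c) (v : X).
have psiE (c : nat -> R) v : psi c v =
    \sum_(s < 4 ^ n) c s * pairing (digit_level n) (digit_block P n s) v.
  by rewrite /psi (pairing_sum p0 Pp).
have normy c : (forall s, `|c s| = 1) -> `|y c| = g.
  exact: normr_block_signs.
have psi_le c v : (forall s, `|c s| = 1) -> `|psi c v| <= `|v| * (k * g).
  move=> c1; apply: (le_trans (ler_pairing p0 Pp _ _ _)); rewrite ler_wpM2l//.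
  have p2 : p <= 2 by rewrite ltW// (lt_trans pq).
  have := normr_digit_signs_le P p1 n p2 c1.
  rewrite -(coupling_block_height pP QE qQ); apply: le_trans.
  by rewrite -(normr_stepL p1) powRKV.
have block_le s (v : X) : (s < 4 ^ n)%N ->
    `|pairing (digit_level n) (digit_block P n s) v| <= `|v| * k.
  move=> sn; apply: (le_trans (ler_pairing p0 Pp _ _ _)); rewrite ler_wpM2l//.
  by rewrite -(normr_stepL p1) powRKV// (normr_digit_block P p1 sn) -(couplingE pP).
clearbody k g.
have pairB M v u u' : pairing M v (u - u' : X) = pairing M v u - pairing M v u'.
  have := pairing_linear p0 Pp M v (-1) u' u.
  by rewrite scaleN1r mulN1r !(addrC (- _)).
have pairD M v u u' : pairing M v (u + u' : X) = pairing M v u + pairing M v u'.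
  by have := pairing_linear p0 Pp M v 1 u u'; rewrite scale1r mul1r.
have pair0 M v : pairing M v (0 : X) = 0.
  by have := pairB M v 0 0; rewrite subr0 subrr.
have pairZ M v c u : pairing M v (c *: u : X) = c * pairing M v u.
  by have := pairing_linear p0 Pp M v c u 0; rewrite addr0 pair0 addr0.
have pairN M v u : pairing M v (- u : X) = - pairing M v u.
  by rewrite -scaleN1r pairZ mulN1r.
have sqr1 (c : nat -> R) s : `|c s| = 1 -> c s * c s = 1.
  by move=> c1; rewrite -expr2 -(real_normK (num_real (c s))) c1 expr1n.
have kg0 : 0 <= g ^+ 2 * k by rewrite mulr_ge0 ?sqr_ge0// ltW.
(* Valid for every choice of signs: [psi c (T (y c))] is [g^2 k], and the error, of norm at most
   [g / 2], changes it by at most half since [psi c] has norm at most [k g]. *)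
have lower c : (forall s, `|c s| = 1) ->
    2^-1 * (g ^+ 2 * k) <= psi c (B (A (y c))).
  move=> c1.
  have e1 : psi c (T (y c)) = g ^+ 2 * k.
    rewrite Ty /psi pairZ -/(psi c _) psiE.
    rewrite (eq_bigr (fun=> k)); last first.
      by move=> s _; rewrite pairx// mulrA sqr1// mul1r.
    rewrite sumr_const card_ord -[k *+ _]mulr_natl DE /w.
    by field; rewrite gt_eqF.
  have e2 : psi c (T (y c) - B (A (y c))) <= 2^-1 * (g ^+ 2 * k).
    apply: (le_trans (ler_norm _)); apply: (le_trans (psi_le c _ c1)).
    apply: (@le_trans _ _ (2^-1 * g * (k * g))).
      rewrite ler_wpM2r ?mulr_ge0 ?(ltW kp)//.
      by rewrite (le_trans (TBA _))// normy.
    by rewrite le_eqVlt; apply/orP; left; apply/eqP; ring.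
  by move: e2; rewrite /psi pairB -/(psi c _) -/(psi c (B _)) e1; clear; lra.
(* A quadratic form, so the parallelogram law holds with equality. At [f s] it is [w] times a
   diagonal entry of [B A], and at [y c] it is [w * psi c (B (A (y c)))]; greedy signs therefore
   bound the latter by the trace. *)
pose Psi v := \sum_(s < 4 ^ n) phi n s v *
  pairing (digit_level n) (digit_block P n s) (B (A v)).
have Psi0 : Psi 0 <= 0.
  by rewrite /Psi big1// => s _; rewrite /phi pair0 mul0r.
have PsiD u v : Psi (u + v) + Psi (u - v) <= 2 * (Psi u + Psi v).
  rewrite /Psi -!big_split mulr_sumr/= le_eqVlt; apply/orP; left; apply/eqP.
  apply: eq_bigr => s _; rewrite /phi !(linearD, linearN)/= !(pairD, pairN).
  ring.
have [eps heps] := exists_signs f (4 ^ n) Psi0 PsiD.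
pose c s : R := (-1) ^+ eps s.
have c1 s : `|c s| = 1 by exact: signE.
have g_gt0 : 0 < g.
  by apply: le_lt_trans hn; rewrite mulr_ge0 ?(ltW D0)// mulr_ge0// mulr_ge0// ltW.
have w_gt0 : 0 < w by rewrite divr_gt0// exprn_gt0.
have Psiy : Psi (y c) = w * psi c (B (A (y c))).
  rewrite psiE mulr_sumr; apply: eq_bigr => s _.
  by rewrite phiy// eqxx; ring.
have Psif s : (s < 4 ^ n)%N -> Psi (f s) <= w * (b * k * `|A (f s)|).
  move=> sn; rewrite /Psi (bigD1 (Ordinal sn))//= big1 ?addr0; last first.
    move=> i; rewrite -val_eqE/= => /negPf si.
    by rewrite (phiy n i (fun j => (j == s)%:R))// eqxx si mul0r mul0r.
  rewrite (phiy n s (fun j => (j == s)%:R))// !eqxx mul1r ler_wpM2l//.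
  apply: (le_trans (ler_norm _)); apply: (le_trans (block_le _ _ sn)).
  by rewrite mulrAC ler_wpM2r ?(ltW kp).
have main : 2^-1 * g ^+ 2 <= b * \sum_(s < 4 ^ n) `|A (f s)|.
  have h1 : w * (2^-1 * (g ^+ 2 * k)) <= w * (b * k * \sum_(s < 4 ^ n) `|A (f s)|).
    apply: (@le_trans _ _ (Psi (y c))); first by rewrite Psiy ler_wpM2l// lower.
    rewrite -(yE c) (le_trans heps)// !mulr_sumr.
    by apply: ler_sum => s _; exact: Psif.
  rewrite ler_pM2l// in h1; rewrite -(ler_pM2r kp); move: h1; clear; lra.
(* A second choice of signs, in the opposite direction, bounds the sum of the [|A (f s)|^2] by a
   single value of [|A y|^2]. *)
have [eps' heps'] := signs_hilbert_ge A (4 ^ n) f.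
(* The optimal weight when Cauchy-Schwarz over [D^2] terms is replaced by termwise
   arithmetic-geometric means; [a + 1] in place of [a] makes it positive. *)
pose t := (a + 1) * g / D.
have t0 : 0 < t by rewrite divr_gt0// mulr_gt0.
have sumA : \sum_(s < 4 ^ n) `|A (f s)| <= D * ((a + 1) * g).
  apply: (@le_trans _ _ (\sum_(s < 4 ^ n) (t^-1 * `|A (f s)| ^+ 2 + t) / 2)).
    apply: ler_sum => s _; rewrite ler_pdivlMr// -(ler_pM2l t0) [t * (_ + t)]mulrDr.
    rewrite [t * (t^-1 * _)]mulrA divff ?gt_eqF// mul1r.
    have := sqr_ge0 (`|A (f s)| - t); rewrite sqrrB; clear; lra.
  rewrite -mulr_suml big_split/= -mulr_sumr sumr_const card_ord.
  rewrite -[t *+ _]mulr_natl DE ler_pdivrMr//.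
  have h1 : \sum_(s < 4 ^ n) `|A (f s)| ^+ 2 <= ((a + 1) * g) ^+ 2.
    apply: (le_trans heps'); rewrite (yE (fun s => (-1) ^+ eps' s)).
    rewrite lerXn2r ?nnegrE ?mulr_ge0 ?(ltW a1)//.
    by rewrite (le_trans (A1 _))// normy// => s; exact: signE.
  have h2 : t^-1 * \sum_(s < 4 ^ n) `|A (f s)| ^+ 2 <= t^-1 * ((a + 1) * g) ^+ 2.
    by rewrite ler_wpM2l// invr_ge0 ltW.
  have h3 : t^-1 * ((a + 1) * g) ^+ 2 = D * ((a + 1) * g).
    by rewrite /t; field; rewrite !gt_eqF.
  have h4 : D ^+ 2 * t = D * ((a + 1) * g) by rewrite /t; field; rewrite gt_eqF.
  by rewrite h4; move: h2; rewrite h3; move: h1; clear; lra.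
have : b * \sum_(s < 4 ^ n) `|A (f s)| <= b * (D * ((a + 1) * g)).
  by rewrite ler_wpM2l.
have : 2 * (b * (a + 1)) * D * g < g * g by rewrite ltr_pM2r.
move: main sumA; clear; lra.
Qed.

End above_two.

Theorem mainTheorem4 (R : realType) :
  (forall (p : R) (hp : 1 < p), p != 2 ->
    let p1 := exponent_ge1 hp in
    exists T : {linear Lp01 p1 -> Lp01 p1},
      [/\ bounded_linear T,
          ellp_strictly_singular p1 T
        & ~ opnorm_closure (@factors_through_ell2 R (Lp01 p1) (Lp01 p1)) T])
  /\
  (forall (p : R) (hp : 1 < p), p < 2 ->
    let p1 := exponent_ge1 hp in
    exists T : {linear Lp01 p1 -> Lp01 p1},
      [/\ bounded_linear T,
          ellp_strictly_singular p1 T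
        & forall J : {linear Lp01 p1 -> ellinfty R}, isometric_embedding J ->
            ~ opnorm_closure (@factors_through_ell2 R (Lp01 p1) (ellinfty R))
                (J \o T)]).
Proof.
have half0 : 0 < 2^-1 :> R by rewrite invr_gt0.
split=> p hp.
- rewrite neq_lt => /orP[p2|p2] p1.
    have [T [Tb Tss TA]] := strictly_singular_not_hilbertian hp p2.
    exists T; split => // /(factors_closure Tb half0).
    move=> [A [B [a [b [a0 b0 Aa Bb TBA]]]]]; apply: (TA A a b) => // x.
    (* The triangle inequality turns closeness to [B A] within [1/2] into the seminorm inequality
       refuted by [TA]. *)
    rewrite -[T x](subrK (B (A x))) addrC (le_trans (ler_normD _ _))//.
    by rewrite lerD.
  have [T [Tb Tss TA]] := strictly_singular_far_from_hilbertian hp p2.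
  exists T; split => // /(factors_closure Tb half0).
  by move=> [A [B [a [b [a0 b0 Aa Bb TBA]]]]]; exact: (TA A B a b).
- move=> p2 p1; have [T [Tb Tss TA]] := strictly_singular_not_hilbertian hp p2.
  exists T; split => // J Jiso.
  (* As [J] preserves norms, an approximation of [J \o T] yields the same seminorm inequality for
     [T], with [B] now mapping into [ellinfty]. *)
  have JTb : bounded_linear (J \o T : {linear Lp01 p1 -> ellinfty R}).
    by have [C hC] := Tb; exists C => x /=; rewrite Jiso.
  move=> /(factors_closure JTb half0).
  move=> [A [B [a [b [a0 b0 Aa Bb TBA]]]]]; apply: (TA A a b) => // x.
  rewrite -Jiso -[J (T x)](subrK (B (A x))) addrC (le_trans (ler_normD _ _))//.
  by rewrite lerD// TBA.
Qed.
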